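(* Let $\Omega$ be an $S$-partitionable poset of rank $d+1$, and consider any block decomposition of $\Delta(\Omega)$ (in the sense of the context). Then for each coatom $\sigma$ of $\Omega$, the blocks corresponding to $\sigma$ can be merged, i.e. the set of blocks corresponding to $\sigma$ can be partitioned into groups and each group replaced by the union of its blocks, in such a way that each resulting class of chains contributes a single $\mathbf{cd}$-word to the $\mathbf{cd}$-index of $\Omega$.
   Context: **Posets.** All posets are finite and graded, with a minimum $\hat 0$ of rank $0$ and a maximum $\hat 1$; $r$ is the rank function, ''rank $d+1$'' means $r(\hat 1)=d+1$, and coatoms are the elements of rank $d$. A lower set of faces (for instance $\Gamma_\sigma$, $\partial\Gamma_\sigma$, $\partial\overline\sigma$ below) is regarded as such a poset by adjoining a maximum $\hat 1$; in particular $\{\emptyset\}$ denotes the rank-one poset $\{\hat0<\hat1\}$. For an element $p$, $\overline p=[\hat 0,p]$; for a set $\mathcal C$ of elements, $\overline{\mathcal C}=\bigcup_{p\in\mathcal C}\overline p$; and $\partial\overline\sigma=\overline\sigma\setminus\{\sigma\}$. A poset is Eulerian if every interval $[x,y]$ with $x<y$ has as many elements of even rank as of odd rank. It is near-Eulerian if it is obtained from an Eulerian poset by deleting a single coatom. For a near-Eulerian poset $\Gamma$, its boundary $\partial\Gamma$ is the closure of the set of all $y$ such that $[y,\hat1]$ is a three-element chain, and its semisuspension $\tilde\Sigma\Gamma$ is the Eulerian poset obtained from $\Gamma$ by adjoining a new coatom $\tau$ covering exactly all $y$ such that $[y,\hat 1]$ is a three-element chain. **$S$-partitionable posets** (recursive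 definition). An Eulerian poset $\Omega$ of rank $d+1$ is $S$-partitionable if either $\Omega=\{\emptyset\}$, or $\Omega$ has rank at least $2$ and there is a partition of $\Omega\setminus\{\hat 1\}$ with one class $P_\sigma\subseteq\overline\sigma$ for each coatom $\sigma$ (an $S$-partition) such that, writing $\Gamma_\sigma=\overline{P_\sigma\setminus\{\sigma\}}$: (a) there is a unique initial coatom $\sigma_1$ with $P_{\sigma_1}=\overline{\sigma_1}$, and $P_{\sigma_1}\setminus\{\sigma_1\}=\partial\overline{\sigma_1}$ is $S$-partitionable of rank $d$; (b) there is a unique terminal coatom $\sigma_t$ with $P_{\sigma_t}=\{\sigma_t\}$; (c) for every other coatom $\sigma$ (called ordinary), $\Gamma_\sigma$ is near-Eulerian of rank $d$, $\Gamma_\sigma=(P_\sigma\setminus\{\sigma\})\uplus\partial\Gamma_\sigma$ (disjoint union), and $\tilde\Sigma\Gamma_\sigma$ is $S$-partitionable of rank $d$ via an $S$-partition whose initial coatom is the added coatom $\tau_\sigma$. **Blocks.** $\Delta(\Omega)$ is the set of all chains of $\Omega\setminus\{\hat0,\hat1\}$, including the empty chain; $r(G)$ is the set of ranks of the elements of a chain $G$. Fix an $S$-partition of $\Omega$. A block decomposition of $\Delta(\Omega)$ with respect to it is a partition of $\Delta(\Omega)$ into blocks, defined by recursion on the rank $d+1$. If $d=0$ the only block is $\{\emptyset\}$ (regarded as corresponding to the unique coatom $\hat0$). If $d=1$ the only block is $\{\{\sigma_1\},\emptyset,\{\sigma_t\}\}$, with bottom chain $\beta(\emptyset)=\{\sigma_1\}$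 and top chain $\tau(\emptyset)=\{\sigma_t\}$. Let $d\ge2$. For each chain $G$ with $d\notin r(G)$, let $\sigma$ be the coatom such that $P_\sigma$ contains the element of $G\cup\{\hat0\}$ of largest rank, and let the bottom chain be $\beta(G)=G\cup\{\sigma\}$. A middle chain of an ordinary coatom $\sigma$ is a chain $F=\hat F\cup\{\sigma\}$ with $\hat F\in\Delta(\partial\Gamma_\sigma)$; fixing an $S$-partition of $\tilde\Sigma\Gamma_\sigma$ with initial coatom $\tau_\sigma$ and a block decomposition of $\Delta(\tilde\Sigma\Gamma_\sigma)$ with respect to it, let $\tilde F$ be the top chain of $\hat F$ in that decomposition; it is a chain of $\Omega$ with rank set $r(\hat F)\cup\{d-1\}$ whose largest element lies in $P_\sigma$. The sets $\{\beta(G),G\}\cup\{F: F\text{ a middle chain with }\tilde F=G\}$ (each with two or three elements) are pairwise disjoint; choose a bijection $G\mapsto\tau(G)$ from $\{G\in\Delta(\Omega): d\notin r(G)\}$ onto the set of chains lying in none of these sets, with $r(\tau(G))=r(G)\cup\{d\}$ (such a bijection exists); $\tau(G)$ is the top chain of $G$. The blocks are the sets $\{\beta(G),G,\tau(G)\}\cup\{F: F\text{ a middle chain with }\tilde F=G\}$, one for each $G$ with $d\notin r(G)$, and such a block corresponds to the coatom contained in $\beta(G)$. **Contribution.** Let $\mathbf a,\mathbf b$ be non-commuting variables and, for $K\subseteq[d]$, $u_K=u_1\cdots u_d$ with $u_i=\mathbf b$ if $i\in K$ and $u_i=\mathbf a$ otherwise. A $\mathbf{cd}$-word of degree $d$ is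 a non-commutative monomial $w(\mathbf c,\mathbf d)$ of degree $d$, where $\mathbf c$ has degree $1$ and $\mathbf d$ degree $2$. A set $\mathcal M$ of chains contributes the single $\mathbf{cd}$-word $w$ if substituting $\mathbf a\mapsto\mathbf a-\mathbf b$, $\mathbf b\mapsto\mathbf b$ in $\sum_{F\in\mathcal M}u_{r(F)}$ gives $w(\mathbf a+\mathbf b,\mathbf{ab}+\mathbf{ba})$. (The $\mathbf{cd}$-index of $\Omega$ is the unique polynomial $\Phi$ in $\mathbf c,\mathbf d$ such that the same substitution in $\sum_{F\in\Delta(\Omega)}u_{r(F)}$ gives $\Phi(\mathbf a+\mathbf b,\mathbf{ab}+\mathbf{ba})$.) *)

(* Defs.v *)
From HB Require Import structures.
From mathcomp Require Import all_boot all_order all_algebra.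
From mathcomp.multinomials Require Import monalg.

Set Implicit Arguments.
Unset Strict Implicit.
Unset Printing Implicit Defensive.

Import Order.TTheory GRing.Theory.

(* The recursions below pass from a poset to lower sets of it (with the maximum
   adjoined) and to semisuspensions of these.  Such posets all live on subsets
   of one finite type, but a semisuspension does not carry the induced order;
   hence a poset is a subset together with its own order relation.  [le] is only
   meaningful on [elts], and the axioms are imposed by [is_poset]. *)
Record fposet (T : finType) := FPoset {
  elts : {set T};
  le : rel T;
  bot : T;
  top : T
}.

Definition poset_of disp (U : finTBPOrderType disp) : fposet U :=
  FPoset [set: U] (fun x y : U => (x <= y)%O) (\bot%O : U) (\top%O : U).

Section Posets.
Variable T : finType.
Implicit Types (X : fposet T) (x y p s : T) (C : {set T}).

Definition is_poset X : Prop :=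
  [/\ {in elts X, reflexive (le X)},
      {in elts X &, antisymmetric (le X)},
      {in elts X & &, transitive (le X)},
      bot X \in elts X /\ {in elts X, forall x, le X (bot X) x} &
      top X \in elts X /\ {in elts X, forall x, le X x (top X)}].

Definition lt X : rel T := [rel x y | (x != y) && le X x y].

Definition is_chain X C : bool :=
  (C \subset elts X) && [forall x in C, forall y in C, le X x y || le X y x].

(* In a graded poset, the length of a longest chain descending from [x]. *)
Definition rank X x : nat :=
  \max_(C : {set T} | is_chain X C && [forall y in C, lt X y x]) #|C|.

Definition covers X x y : bool :=
  lt X x y && ~~ [exists z in elts X, lt X x z && lt X z y].

Definition graded X : Prop :=
  is_poset X /\
  {in elts X &, forall x y, covers X x y -> rank X y = (rank X x).+1}.

Definition segment X x y : {set T} := [set z in elts X | le X x z & le X z y].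

Definition eulerian X : Prop :=
  graded X /\
  {in elts X &, forall x y, lt X x y ->
     #|[set z in segment X x y | ~~ odd (rank X z)]|
     = #|[set z in segment X x y | odd (rank X z)]|}.

(* [dimn X = d] when [X] has rank [d + 1]. *)
Definition dimn X : nat := (rank X (top X)).-1.

Definition coatoms X : {set T} :=
  [set s in elts X | (rank X s).+1 == rank X (top X)].

Definition below X p : {set T} := [set x in elts X | le X x p].

Definition lower_closure X C : {set T} := \bigcup_(p in C) below X p.

(* A lower set [L] of faces as a poset: the top of [X] is the adjoined maximum. *)
Definition face_poset X (L : {set T}) : fposet T :=
  FPoset (top X |: L) (le X) (bot X) (top X).

Definition boundary X : {set T} :=
  lower_closure X [set y in elts X | is_chain X (segment X y (top X)) &
                              #|segment X y (top X)| == 3].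

(* The semisuspension of [X]; [t] is the name of the new coatom and is meant to
   lie outside [elts X]. *)
Definition semisusp X (t : T) : fposet T :=
  FPoset (t |: elts X)
    (fun x y => if y == t then (x == t) || (x \in boundary X)
                else if x == t then y == top X
                else le X x y)
    (bot X) (top X).

End Posets.

Definition near_eulerian (T : finType) (X : fposet T) : Prop :=
  graded X /\
  exists (disp : Order.disp_t) (U : finTBPOrderType disp) (c : U) (f : T -> U),
    [/\ eulerian (poset_of U), c \in coatoms (poset_of U),
        {in elts X &, injective f}, f @: elts X = [set~ c] &
        {in elts X &, forall x y, le X x y = (f x <= f y)%O}].

Section Partitions.
Variable T : finType.
Implicit Types (X : fposet T) (G C : {set T}).

Section Partition.
Variables (X : fposet T) (P : T -> {set T}).

(* The set [P s], for [s] a coatom, is the class of [s]; the values of [P] off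
   the coatoms are irrelevant. *)
Definition coatom_partition : Prop :=
  [/\ partition (P @: coatoms X) (elts X :\ top X),
      {in coatoms X &, injective P} &
      {in coatoms X, forall s, P s \subset below X s}].

Definition initials : {set T} := [set s in coatoms X | P s == below X s].
Definition terminals : {set T} := [set s in coatoms X | P s == [set s]].
Definition ordinary : {set T} := coatoms X :\: (initials :|: terminals).

Definition Gamma s : fposet T := face_poset X (lower_closure X (P s :\ s)).

Definition bdGamma s : fposet T := face_poset X (boundary (Gamma s)).

(* As [s] is not an element of [Gamma s], it can name the added coatom. *)
Definition suspGamma s : fposet T := semisusp (Gamma s) s.

End Partition.

(* [S_partition X P]: [X] is S-partitionable via the S-partition [P].  The
   rank-one poset is given its only partition, with the single class {0}. *)
Inductive S_partition : fposet T -> (T -> {set T}) -> Prop :=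
| S_partition_rank1 X P :
    eulerian X -> rank X (top X) = 1 -> P (bot X) = [set bot X] ->
    S_partition X P
| S_partition_step X P (s1 st : T) (P1 : T -> {set T}) (Q : T -> T -> {set T}) :
    eulerian X -> 2 <= rank X (top X) -> coatom_partition X P ->
    initials X P = [set s1] ->
    S_partition (face_poset X (P s1 :\ s1)) P1 ->
    (rank (face_poset X (P s1 :\ s1)) (top X)).+1 = rank X (top X) ->
    terminals X P = [set st] ->
    {in ordinary X P, forall s, near_eulerian (Gamma X P s)} ->
    {in ordinary X P, forall s,
       (rank (Gamma X P s) (top X)).+1 = rank X (top X)} ->
    {in ordinary X P, forall s,
       lower_closure X (P s :\ s) = (P s :\ s) :|: boundary (Gamma X P s)} ->
    {in ordinary X P, forall s, [disjoint P s :\ s & boundary (Gamma X P s)]} ->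
    (forall s, s \in ordinary X P -> S_partition (suspGamma X P s) (Q s)) ->
    {in ordinary X P, forall s,
       (rank (suspGamma X P s) (top X)).+1 = rank X (top X)} ->
    {in ordinary X P, forall s, s \in initials (suspGamma X P s) (Q s)} ->
    S_partition X P.

Definition Delta X : {set {set T}} :=
  [set C : {set T} | (C \subset elts X :\: [set bot X; top X]) & is_chain X C].

Definition ranks X C : seq nat := [seq rank X x | x in C].

Definition low_chains X : {set {set T}} :=
  [set G in Delta X | dimn X \notin ranks X G].

(* The element of largest rank of [G :|: {0}]. *)
Definition largest X G : T := [arg max_(p > bot X in bot X |: G) rank X p].

Section Blocks.
Variables (X : fposet T) (P : T -> {set T}).

(* [G] together with the coatom whose class contains [largest X G]. *)
Definition bottom_chain G : {set T} :=
  G :|: [set s in coatoms X | largest X G \in P s].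

(* Middle chains [F] with F~ = [G]; [ts s] is the top chain map of the chosen
   block decomposition of the semisuspension at [s]. *)
Definition middle_chains (ts : T -> {set T} -> {set T}) G : {set {set T}} :=
  [set s |: Fh | s in ordinary X P, Fh in Delta (bdGamma X P s) & ts s Fh == G].

Definition partial_block ts G : {set {set T}} :=
  [set bottom_chain G; G] :|: middle_chains ts G.

(* The chains that remain to be used as top chains. *)
Definition free_chains ts : {set {set T}} :=
  Delta X :\: \bigcup_(G in low_chains X) partial_block ts G.

End Blocks.

(* [block_decomposition X P B t]: for [G] in [low_chains X], [B G] is the block
   of [G] and [t G] its top chain; other values of [B] and [t] are irrelevant. *)
Inductive block_decomposition :
    fposet T -> (T -> {set T}) -> ({set T} -> {set {set T}}) ->
    ({set T} -> {set T}) -> Prop :=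
| Block_dim0 X P B t :
    dimn X = 0 -> B set0 = [set set0] -> block_decomposition X P B t
| Block_dim1 X P B t (s1 st : T) :
    dimn X = 1 -> initials X P = [set s1] -> terminals X P = [set st] ->
    t set0 = [set st] -> B set0 = [set [set s1]; set0; [set st]] ->
    block_decomposition X P B t
| Block_step X P B t (Q : T -> T -> {set T})
    (Bs : T -> {set T} -> {set {set T}}) (ts : T -> {set T} -> {set T}) :
    2 <= dimn X ->
    {in ordinary X P, forall s, S_partition (suspGamma X P s) (Q s)} ->
    {in ordinary X P, forall s, s \in initials (suspGamma X P s) (Q s)} ->
    (forall s, s \in ordinary X P ->
       block_decomposition (suspGamma X P s) (Q s) (Bs s) (ts s)) ->
    {in low_chains X &, injective t} ->
    t @: low_chains X = free_chains X P ts ->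
    {in low_chains X, forall G, ranks X (t G) =i dimn X :: ranks X G} ->
    {in low_chains X, forall G, B G = t G |: partial_block X P ts G} ->
    block_decomposition X P B t.

(* The blocks corresponding to the coatom [s].  This also covers rank one, where
   the coatom 0 lies in [bottom_chain X P set0]. *)
Definition blocks_of X P (B : {set T} -> {set {set T}}) (s : T) :
    {set {set {set T}}} :=
  [set B G | G in low_chains X & s \in bottom_chain X P G].

End Partitions.

Local Open Scope ring_scope.

(* The free ring Z<a, b>. *)
Definition abring := {malg int[{fmonom bool}]}.
Definition va : abring := << fmu false >>.
Definition vb : abring := << fmu true >>.

(* The value of the word u_K of degree d at a = x and b = y. *)
Definition ab_word (d : nat) (K : seq nat) (x y : abring) : abring :=
  \prod_(1 <= i < d.+1) (if i \in K then y else x).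

Inductive cd_letter := Letter_c | Letter_d.

Definition cd_degree (w : seq cd_letter) : nat :=
  \sum_(l <- w) (if l is Letter_c then 1 else 2)%N.

Definition cd_word (w : seq cd_letter) (x y : abring) : abring :=
  \prod_(l <- w) (if l is Letter_c then x else y).

Definition contributes (T : finType) (X : fposet T) (M : {set {set T}})
    (w : seq cd_letter) : Prop :=
  cd_degree w = dimn X /\
  \sum_(F in M) ab_word (dimn X) (ranks X F) (va - vb) vb
  = cd_word w (va + vb) (va * vb + vb * va).

(* Main.v *)
Require Import Defs.
From mathcomp Require Import all_boot all_order all_algebra.
From mathcomp.multinomials Require Import monalg.

(** Before the substitution of a - b for a, the letters c and d are a + 2b and
    ab + ba + 2bb, sums of words in a and b.  A set of chains thus contributes a
    cd-word as soon as its rank words form, with multiplicities, the expansion of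
    that word.  Since words are linearly independent, a family of chains can be
    grouped in this way whenever the sum of its rank words is a sum of cd-words
    ([cdsum], [grouping]).  Only sums of rank words have to be computed.

    The blocks of a coatom s are indexed by the chains G below the top rank whose
    largest element lies in the class of s.  A block without middle chain has the
    value u(G) c.  If it has a middle chain, made from a chain F of the boundary of
    Gamma_s, its value is u(F) d ([sum_block], [c_block], [d_block]).  A block
    decomposition enters only through the rank sets and the injectivity of its top
    chains ([middle_top_chain]).  So two sums must be sums of cd-words: the one of
    u(F) over the chains F of the boundary, and the one of u(G) over the chains G
    of the class that are not top chains of such an F.

    Let Psi(X) be the sum of the rank words of all chains of X, let Y be the
    semisuspension of Gamma_s and D its boundary, which is the boundary of the
    added coatom of Y.  Sorting the chains of Y by their relation to D
    ([class_chainsE], [Psi_class]) shows that the second sum is Psi(Y) - Psi(D) c.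
    As the added coatom is the initial one of Y, both sums are covered by
    [S_partition_positive]: for an S-partitionable X with initial coatom s1 and
    boundary D1 of s1, all of Psi(X), Psi(D1) and Psi(X) - Psi(D1) c are sums of
    cd-words.  This follows by induction from the recursion of Stanley

      Psi(X) - Psi(D1) c = sum over ordinary s of (Psi(Y) - Psi(D) c) c + Psi(D) d

    ([Psi_step], [cd_algebra]).  The recursion in turn comes from the number of
    coatoms above an element p below the top rank: it is 2 plus the number of
    ordinary s with p in the boundary of Gamma_s ([coatom_count]).  This is the
    Eulerian relation of the interval from p to the top, read class by class. *)

Set Implicit Arguments.
Unset Strict Implicit.
Unset Printing Implicit Defensive.

Import Order.TTheory GRing.Theory Num.Theory.

(** * Rank words and sums of cd-words *)

Section Words.
Local Open Scope ring_scope.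

(** The letter [false] stands for a and [true] for b, as in [va] and [vb]. *)
Definition word_eval (x y : abring) (u : seq bool) : abring :=
  \prod_(b <- u) (if b then y else x).

Definition word (n : nat) (K : seq nat) : seq bool :=
  [seq i \in K | i <- index_iota 1 n.+1].

Lemma ab_wordE n K x y : ab_word n K x y = word_eval x y (word n K).
Proof. by rewrite /word_eval big_map. Qed.

Lemma word_eval_cat x y u v :
  word_eval x y (u ++ v) = word_eval x y u * word_eval x y v.
Proof. by rewrite /word_eval big_cat. Qed.

Lemma word_eval_monomial u : word_eval va vb u = << FMonom u >>.
Proof.
elim: u => [|b u IH].
  by rewrite /word_eval big_nil -fmoneE.
rewrite -cat1s word_eval_cat IH {1}/word_eval big_seq1 malgM_def.
have -> : (if b then vb else va) = << FMonom [:: b] >>.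
  by case: b; rewrite /va /vb fmuE.
by rewrite fgmulUU mulr1; congr (<< _ >>); apply: fmmulE.
Qed.

Lemma ab_word_recr n K x y :
  ab_word n.+1 K x y = ab_word n K x y * (if n.+1 \in K then y else x).
Proof. by rewrite /ab_word big_nat_recr. Qed.

Lemma eq_ab_word n K K' x y :
  (forall i, 1 <= i <= n -> (i \in K) = (i \in K'))%N ->
  ab_word n K x y = ab_word n K' x y.
Proof. by move=> eqK; apply: eq_big_nat => i /eqK ->. Qed.

(** Distinct words are linearly independent in the free ring, so an equality of
    sums is an equality of multisets. *)
Lemma perm_of_sum_words (r s : seq (seq bool)) :
  \sum_(u <- r) word_eval va vb u = \sum_(u <- s) word_eval va vb u ->
  perm_eq r s.
Proof.
have coef (q : seq (seq bool)) u :
    (\sum_(v <- q) word_eval va vb v)@_(FMonom u) = (count_mem u q)%:R.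
  elim: q => [|v q IH]; first by rewrite big_nil mcoeff0.
  rewrite big_cons mcoeffD IH word_eval_monomial mcoeffU1 /= natrD.
  by congr (_%:R + _).
move=> eq_rs; apply/allP => u _; apply/eqP.
by apply/eqP; rewrite -(eqr_nat int) -!coef eq_rs.
Qed.

(** The change of variables of the cd-index sends a to a - b.  Undoing it turns
    c = a + b into a + 2b and d = ab + ba into ab + ba + 2bb, and these have
    nonnegative coefficients: a letter is a multiset of words. *)
Definition letter_words (l : cd_letter) : seq (seq bool) :=
  if l is Letter_c then [:: [:: false]; [:: true]; [:: true]]
  else [:: [:: false; true]; [:: true; false]; [:: true; true]; [:: true; true]].

Fixpoint cd_words (w : seq cd_letter) : seq (seq bool) :=
  if w is l :: w' then [seq u ++ v | u <- letter_words l, v <- cd_words w']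
  else [:: [::]].

Lemma sum_letter_words (R : nzRingType) (x y : R) l :
  \sum_(u <- letter_words l) \prod_(b <- u) (if b then y else x)
  = if l is Letter_c then x + y + y else x * y + y * x + y * y + y * y.
Proof.
by case: l; rewrite /= !big_cons !big_nil !mulr1 addr0 ?addrA.
Qed.

Lemma sum_cd_words w x y :
  \sum_(u <- cd_words w) word_eval x y u
  = cd_word w (x + y + y) (x * y + y * x + y * y + y * y).
Proof.
elim: w => [|l w IH]; first by rewrite /= big_seq1 /word_eval /cd_word !big_nil.
rewrite /cd_word big_cons -/(cd_word _ _ _) -IH.
rewrite big_allpairs_dep.
under eq_bigr => u _ do
  (under eq_bigr => v _ do rewrite word_eval_cat; rewrite -mulr_sumr).
rewrite -mulr_suml; congr (_ * _).
by rewrite /word_eval sum_letter_words; case: l.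
Qed.

Lemma cd_words_neq0 w : cd_words w != [::].
Proof.
elim: w => //= l w; rewrite -!size_eq0 size_allpairs => IH.
by rewrite muln_eq0 negb_or IH; case: l.
Qed.

Lemma cd_degree_rcons w l :
  cd_degree (rcons w l) = (cd_degree w + (if l is Letter_c then 1 else 2))%N.
Proof. by rewrite /cd_degree -cats1 big_cat big_seq1. Qed.

Lemma cd_word_rcons w l x y :
  cd_word (rcons w l) x y = cd_word w x y * (if l is Letter_c then x else y).
Proof. by rewrite /cd_word -cats1 big_cat big_seq1. Qed.

(** The letters c and d before the substitution of a - b for a. *)
Definition cwt : abring := va + vb + vb.
Definition dwt : abring := va * vb + vb * va + vb * vb + vb * vb.

(** This is what makes grouping possible: by linear independence of words, the
    rank words of a family of chains with such a sum split into expansions of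
    single cd-words. *)
Definition cdsum (n : nat) (f : abring) : Prop :=
  exists2 ws : seq (seq cd_letter), all (fun w => cd_degree w == n) ws &
    f = \sum_(w <- ws) cd_word w cwt dwt.

Lemma cdsum0 n : cdsum n 0.
Proof. by exists [::]; rewrite ?big_nil. Qed.

Lemma cdsumD n f g : cdsum n f -> cdsum n g -> cdsum n (f + g).
Proof.
move=> [r dr ->] [s ds ->]; exists (r ++ s); first by rewrite all_cat dr ds.
by rewrite big_cat.
Qed.

Lemma cdsum_sum (I : finType) (A : {pred I}) n (f : I -> abring) :
  (forall i, i \in A -> cdsum n (f i)) -> cdsum n (\sum_(i in A) f i).
Proof. by move=> fP; apply: big_ind => //; [apply: cdsum0 | move=> *; apply: cdsumD]. Qed.

Lemma cdsumMl n f l : cdsum n f ->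
  cdsum (n + (if l is Letter_c then 1 else 2))
        (f * (if l is Letter_c then cwt else dwt)).
Proof.
move=> [ws dw ->]; exists [seq rcons w l | w <- ws].
  rewrite all_map; apply: sub_all dw => w /= /eqP <-.
  by rewrite cd_degree_rcons.
by rewrite big_map mulr_suml; apply: eq_bigr => w _; rewrite cd_word_rcons.
Qed.

Lemma cdsumMc n f : cdsum n f -> cdsum n.+1 (f * cwt).
Proof. by move/(cdsumMl Letter_c); rewrite addn1. Qed.

Lemma cdsumMd n f : cdsum n f -> cdsum n.+2 (f * dwt).
Proof. by move/(cdsumMl Letter_d); rewrite addn2. Qed.

Lemma cdsum_one : cdsum 0 1.
Proof.
exists [:: [::]]; first by rewrite /= /cd_degree big_nil.
by rewrite big_seq1 /cd_word big_nil.
Qed.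

Section Grouping.
Variables (I : finType) (v : I -> seq bool).

Lemma perm_image_setD1 (S : {set I}) i :
  i \in S -> perm_eq [seq v j | j in S] (v i :: [seq v j | j in S :\ i]).
Proof.
move=> Si; rewrite -map_cons; apply: perm_map.
apply: uniq_perm; rewrite /= ?enum_uniq ?mem_enum ?inE ?eqxx // => j.
by rewrite !inE !mem_enum !inE; case: eqVneq => // ->.
Qed.

(** A multiset equality between the words of [S] and a concatenation [l ++ r] is
    realized by elements: pick preimages of the words of [l] one at a time. *)
Lemma split_image (l r : seq (seq bool)) (S : {set I}) :
  perm_eq [seq v i | i in S] (l ++ r) ->
  exists N : {set I}, [/\ N \subset S, perm_eq [seq v i | i in N] l
                        & perm_eq [seq v i | i in S :\: N] r].
Proof.
elim: l S => [|k l IH] S /= permS.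
  by exists set0; rewrite sub0set setD0 /image_mem enum_set0.
have /imageP[i Si def_k] : k \in [seq v i | i in S].
  by rewrite (perm_mem permS) mem_head.
have := permS; rewrite def_k (perm_sym _ (_ :: _)).
rewrite (permPr (perm_image_setD1 Si)) perm_cons perm_sym.
case/IH=> N [sNS permN permr]; exists (i |: N); split.
- by rewrite subUset sub1set Si (subset_trans sNS) ?subsetDl.
- have Ni : i \notin N by apply/negP => /(subsetP sNS); rewrite !inE eqxx.
  rewrite (permPl (perm_image_setD1 (setU11 i N))) perm_cons.
  by rewrite setU1K.
- by rewrite -setDDl.
Qed.

(** Equality of the sums gives an equality of multisets of words, and the
    expansions of the successive cd-words are then carved out of [S]. *)
Lemma grouping n (S : {set I}) :
  cdsum n (\sum_(i in S) word_eval va vb (v i)) ->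
  exists2 M : {set {set I}}, partition M S &
    forall N, N \in M -> exists2 w, cd_degree w = n &
      perm_eq [seq v i | i in N] (cd_words w).
Proof.
case=> ws dws eqS; have {eqS}: perm_eq [seq v i | i in S] (flatten (map cd_words ws)).
  apply: perm_of_sum_words; rewrite big_image /= eqS big_flatten /= big_map.
  by apply: eq_bigr => w _; rewrite sum_cd_words.
elim: ws dws S => [_ S|w ws IH /andP[/eqP dw /IH{}IH] S].
  move=> /perm_size/eqP; rewrite size_image cards_eq0 => /eqP->.
  by exists set0; [rewrite partition_set0 | move=> N; rewrite inE].
case/split_image=> N [sNS permN /IH[M partM MP]].
exists (N |: M).
  rewrite -(setID S N) (setIidPr sNS); apply: partitionU1 => //.
    apply: contraNneq (cd_words_neq0 w) => N0.
    by rewrite -size_eq0 -(perm_size permN) size_image N0 cards0.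
  by rewrite disjoint_sym disjoints_subset subDset setUCr subsetT.
by move=> N'; rewrite in_setU1 => /predU1P[-> | /MP//]; exists w.
Qed.

End Grouping.
End Words.

(** * Rank, lower sets and chains *)

Section PosetRank.
Variable T : finType.
Implicit Types (X Y : fposet T) (x y p s : T) (C L : {set T}).

Lemma is_chainP X C :
  reflect (C \subset elts X /\ {in C &, forall x y, le X x y || le X y x})
          (is_chain X C).
Proof.
apply: (iffP andP) => -[sC chC]; split=> //.
  by move=> x y Cx Cy; move/forall_inP/(_ x Cx)/forall_inP: chC => /(_ y Cy).
by apply/forall_inP => x Cx; apply/forall_inP => y Cy; apply: chC.
Qed.

Lemma sub_is_chain X C C' : C' \subset C -> is_chain X C -> is_chain X C'.
Proof.
move=> /subsetP sC /is_chainP[/subsetP sCX chC]; apply/is_chainP; split.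
  by apply/subsetP => x /sC/sCX.
by move=> x y /sC Cx /sC Cy; apply: chC.
Qed.

Lemma eq_is_chain X Y C : C \subset elts X -> C \subset elts Y ->
  {in C &, le X =2 le Y} -> is_chain X C = is_chain Y C.
Proof.
by move=> sX sY eqle; apply/is_chainP/is_chainP=> -[_ chC]; split=> // x y Cx Cy;
  have := chC x y Cx Cy; rewrite !eqle.
Qed.

(** The rank of [x] only depends on the elements strictly below it.  This is how
    ranks are transported between a poset, its lower sets and semisuspensions. *)
Lemma eq_rank X Y x :
  [set z in elts X | lt X z x] = [set z in elts Y | lt Y z x] ->
  {in [set z in elts X | lt X z x] &, le X =2 le Y} ->
  rank X x = rank Y x.
Proof.
move=> eqS eqle; apply: eq_bigl => C.
have chP Z : is_chain Z C && [forall y in C, lt Z y x]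
           = (C \subset [set z in elts Z | lt Z z x]) && is_chain Z C.
  apply/andP/andP => [[chC /forall_inP ltC]|[/subsetP sC chC]]; split=> //.
    apply/subsetP => y Cy; rewrite inE ltC // andbT.
    by have [/subsetP->] := is_chainP _ _ chC.
  by apply/forall_inP => y /sC; rewrite inE => /andP[].
rewrite !chP -eqS; apply: andb_id2l => sC; apply: eq_is_chain.
- by apply/subsetP => z /(subsetP sC); rewrite inE => /andP[].
- by apply/subsetP => z /(subsetP sC); rewrite eqS inE => /andP[].
- by move=> y z /(subsetP sC) Sy /(subsetP sC) Sz; apply: eqle.
Qed.

(** Only sets of proper faces are allowed, since the maximum of [face_poset] is
    adjoined afterwards. *)
Definition lower_set X L : Prop :=
  L \subset elts X :\ top X /\
  {in L, forall x, {in elts X, forall z, le X z x -> z \in L}}.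

Section OnePoset.
Variable X : fposet T.
Hypothesis posX : is_poset X.

Lemma ple_refl : {in elts X, reflexive (le X)}. Proof. by case: posX. Qed.
Lemma ple_anti : {in elts X &, antisymmetric (le X)}. Proof. by case: posX. Qed.
Lemma ple_tr y x z : x \in elts X -> y \in elts X -> z \in elts X ->
  le X x y -> le X y z -> le X x z.
Proof. by move=> ? ? ?; case: posX => _ _ tr _ _; apply: tr. Qed.
Lemma bot_elt : bot X \in elts X. Proof. by case: posX => _ _ _ []. Qed.
Lemma top_elt : top X \in elts X. Proof. by case: posX => _ _ _ _ []. Qed.
Lemma ple_bot x : x \in elts X -> le X (bot X) x.
Proof. by case: posX => _ _ _ [] _ H _; apply: H. Qed.
Lemma ple_top x : x \in elts X -> le X x (top X).
Proof. by case: posX => _ _ _ _ [] _; apply. Qed.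

Lemma ple_eq x y : x \in elts X -> y \in elts X -> le X x y -> le X y x -> x = y.
Proof. by move=> Xx Xy xy yx; apply: ple_anti; rewrite ?xy. Qed.

(** A chain below [x] is extended by [x] to a chain below [y]. *)
Lemma rank_lt x y : x \in elts X -> y \in elts X -> lt X x y -> rank X x < rank X y.
Proof.
move=> Xx Xy /andP[neq_xy le_xy].
have ext C : is_chain X C && [forall z in C, lt X z x] -> #|C| < rank X y.
  case/andP=> /is_chainP[/subsetP sC chC] /forall_inP ltC.
  have Cx : x \notin C by apply/negP => /ltC /andP[]; rewrite eqxx.
  rewrite /rank.
  apply: (bigop.bigmax_sup (x |: C)); last by rewrite cardsU1 Cx.
  have le_zx z : z \in x |: C -> le X z x.
    by rewrite in_setU1 => /predU1P[->|/ltC/andP[]//]; apply: ple_refl.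
  have sxC : x |: C \subset elts X.
    by apply/subsetP => z; rewrite in_setU1 => /predU1P[->|/sC].
  apply/andP; split.
    apply/is_chainP; split=> // z z' /[dup] /le_zx zx /setU1P[->|Cz].
      by move/le_zx => ->; rewrite orbT.
    by case/setU1P=> [->|Cz']; [rewrite zx | apply: chC].
  apply/forall_inP => z xCz; rewrite /lt /=.
  have Xz := subsetP sxC _ xCz.
  rewrite (ple_tr Xz Xx Xy (le_zx _ xCz) le_xy) andbT.
  apply: contra neq_xy => /eqP eq_zy.
  by rewrite -eq_zy; apply/eqP/ple_eq; rewrite ?le_zx // eq_zy.
rewrite -[ltnRHS]prednK; first by rewrite ltnS; apply/bigmax_leqP => C /ext; case: (rank X y).
apply: leq_ltn_trans (ext set0 _) => //.
apply/andP; split; last by apply/forall_inP => z; rewrite inE.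
by apply/is_chainP; split; rewrite ?sub0set // => z z'; rewrite inE.
Qed.

Lemma rank_bot : rank X (bot X) = 0.
Proof.
apply/eqP; rewrite -leqn0; apply/bigmax_leqP => C /andP[/andP[/subsetP sC _] /forall_inP ltC].
rewrite leqn0 cards_eq0 -subset0; apply/subsetP => x Cx.
have /andP[/eqP[]] := ltC x Cx.
by apply: ple_eq; rewrite ?ple_bot ?bot_elt ?sC //; case/andP: (ltC x Cx).
Qed.

Lemma rank_gt0 x : x \in elts X -> (0 < rank X x) = (x != bot X).
Proof.
move=> Xx; have [->|neq] := eqVneq; first by rewrite rank_bot.
apply: leq_ltn_trans (rank_lt bot_elt Xx _) => //.
by rewrite /lt /= eq_sym neq ple_bot.
Qed.

Lemma rank_lt_top x : x \in elts X -> (rank X x < rank X (top X)) = (x != top X).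
Proof.
move=> Xx; have [->|neq] := eqVneq; first by rewrite ltnn.
by apply: rank_lt; rewrite ?top_elt // /lt /= neq ple_top.
Qed.

Lemma coatom_elt s : s \in coatoms X -> s \in elts X.
Proof. by rewrite inE => /andP[]. Qed.

Lemma coatom_neq_top s : s \in coatoms X -> s != top X.
Proof.
by rewrite inE => /andP[Xs /eqP eq_r]; rewrite -rank_lt_top // -eq_r.
Qed.

Lemma coatom_rank s : s \in coatoms X -> rank X s = dimn X.
Proof. by rewrite inE /dimn => /andP[_ /eqP <-]. Qed.

Lemma coatomE s : 0 < dimn X -> s \in elts X -> (s \in coatoms X) = (rank X s == dimn X).
Proof.
by rewrite inE /dimn => d_gt0 ->; case: (rank X (top X)) d_gt0.
Qed.

Lemma lt_coatom s x : s \in coatoms X -> x \in elts X -> le X x s -> x != s ->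
  rank X x < dimn X.
Proof.
move=> Cs Xx le_xs neq; rewrite -(coatom_rank Cs).
by apply: rank_lt => //; rewrite ?(coatom_elt Cs) // /lt /= neq.
Qed.

Lemma lower_elt L x : lower_set X L -> x \in L -> x \in elts X.
Proof. by case=> /subsetP sL _ /sL /setD1P[]. Qed.

Lemma lower_strict_below s : s \in elts X -> s != top X -> lower_set X (below X s :\ s).
Proof.
move=> Xs s1; split.
  apply/subsetP => x; rewrite !inE => /and3P[neq Xx le_xs]; rewrite Xx andbT.
  apply: contra s1 => /eqP x1; apply/eqP/ple_eq; rewrite ?top_elt ?ple_top //.
  by rewrite -x1.
move=> x; rewrite !inE => /and3P[neq Xx le_xs] z Xz le_zx.
rewrite !inE Xz (ple_tr Xz Xx Xs le_zx le_xs) !andbT.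
apply: contra neq => /eqP zs; apply/eqP/ple_eq=> //.
by rewrite -zs.
Qed.

Lemma lower_below s : s \in elts X -> s != top X -> lower_set X (below X s).
Proof.
move=> Xs s1; split.
  apply/subsetP => x; rewrite !inE => /andP[Xx le_xs]; rewrite Xx andbT.
  apply: contra s1 => /eqP x1; apply/eqP/ple_eq; rewrite ?top_elt ?ple_top //.
  by rewrite -x1.
move=> x; rewrite !inE => /andP[Xx le_xs] z Xz le_zx.
by rewrite !inE Xz (ple_tr Xz Xx Xs le_zx le_xs).
Qed.

Lemma lower_closure_lower C : C \subset elts X :\ top X -> lower_set X (lower_closure X C).
Proof.
move=> /subsetP sC.
have lowC c : c \in C -> lower_set X (below X c).
  by move=> /sC /setD1P[c1 Xc]; apply: lower_below.
split.
  by apply/bigcupsP => c Cc; case: (lowC c Cc).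
move=> x /bigcupP[c Cc cx] z Xz zx; apply/bigcupP; exists c => //.
by case: (lowC c Cc) => _ /(_ x cx); apply.
Qed.

Lemma DeltaP C :
  reflect [/\ C \subset elts X, bot X \notin C, top X \notin C
            & {in C &, forall x y, le X x y || le X y x}]
          (C \in Delta X).
Proof.
rewrite inE subsetD; apply: (iffP andP).
  case=> /andP[sC disC] /is_chainP[_ chC]; split=> //.
    by apply/negP => C0; have /pred0P/(_ (bot X)) := disC; rewrite /= C0 !inE eqxx.
  by apply/negP => C0; have /pred0P/(_ (top X)) := disC; rewrite /= C0 !inE eqxx orbT.
case=> sC C0 C1 chC; split; last by apply/is_chainP.
rewrite sC; apply/pred0P => x /=; rewrite !inE; apply/negP => /andP[Cx].
by case/orP=> /eqP xE; move: C0 C1; rewrite -xE Cx.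
Qed.

Lemma Delta_elt C x : C \in Delta X -> x \in C -> x \in elts X.
Proof. by case/DeltaP=> /subsetP sC _ _ _ /sC. Qed.

Lemma Delta_rank_gt0 C x : C \in Delta X -> x \in C -> 0 < rank X x.
Proof.
move=> DC Cx; rewrite rank_gt0 ?(Delta_elt DC) //.
by case/DeltaP: DC => _ C0 _ _; apply: contraNneq C0 => <-.
Qed.

Lemma Delta_rank_le C x : C \in Delta X -> x \in C -> rank X x <= dimn X.
Proof.
move=> DC Cx; have : rank X x < rank X (top X).
  rewrite rank_lt_top ?(Delta_elt DC) //.
  by case/DeltaP: DC => _ _ C1 _; apply: contraNneq C1 => <-.
by rewrite /dimn; case: (rank X (top X)).
Qed.

Lemma sub_Delta C C' : C' \subset C -> C \in Delta X -> C' \in Delta X.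
Proof.
by rewrite !inE => sC /andP[/(subset_trans sC)-> /(sub_is_chain sC)->].
Qed.

Lemma Delta_comp_eq C x y : C \in Delta X -> x \in C -> y \in C ->
  rank X x = rank X y -> x = y.
Proof.
move=> DC Cx Cy eq_r; have [Xx Xy] := (Delta_elt DC Cx, Delta_elt DC Cy).
have [//|neq] := eqVneq x y; case/DeltaP: DC => _ _ _ /(_ x y Cx Cy).
case/orP=> le_.
  by have := rank_lt Xx Xy; rewrite /lt /= le_ neq eq_r ltnn => /(_ isT).
by have := rank_lt Xy Xx; rewrite /lt /= le_ eq_sym neq eq_r ltnn => /(_ isT).
Qed.

Lemma ranksP C i : reflect (exists2 x, x \in C & i = rank X x) (i \in ranks X C).
Proof. exact: imageP. Qed.

Lemma largestP C : C \in Delta X ->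
  largest X C \in bot X |: C /\ {in bot X |: C, forall x, le X x (largest X C)}.
Proof.
move=> DC; rewrite /largest; case: arg_maxnP => [|p pC maxp]; first exact: setU11.
split=> // x xC; have elC y : y \in bot X |: C -> y \in elts X.
  by case/setU1P=> [->|/(Delta_elt DC)//]; apply: bot_elt.
have /orP[//|px] : le X x p || le X p x.
  case/setU1P: (xC) => [->|Cx]; first by rewrite ple_bot ?elC.
  case/setU1P: (pC) => [->|Cp]; first by rewrite orbC ple_bot ?elC ?setU1r.
  by case/DeltaP: DC => _ _ _; apply.
have [->|neq] := eqVneq p x; first by rewrite ple_refl ?elC.
have := rank_lt (elC _ pC) (elC _ xC); rewrite /lt /= neq px ltnNge => /(_ isT).
by rewrite [_ <= _](maxp x xC).
Qed.

Lemma largest_elt C : C \in Delta X -> largest X C \in elts X.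
Proof.
by move=> DC; case: (largestP DC) => /setU1P[->|/(Delta_elt DC)//] _; apply: bot_elt.
Qed.

Lemma largest_neq_top C : 0 < dimn X -> C \in Delta X -> largest X C != top X.
Proof.
move=> d_gt0 DC; case: (largestP DC) => /setU1P[->|Cp] _.
  by rewrite -rank_lt_top ?bot_elt // rank_bot; move: d_gt0; rewrite /dimn; case: rank.
by case/DeltaP: DC => _ _ C1 _; apply: contraNneq C1 => <-.
Qed.

(** Every element of a chain lies below its largest one, so membership of the
    largest element in a lower set decides membership of the whole chain. *)
Lemma largest_lower C L : lower_set X L -> bot X \in L -> C \in Delta X ->
  (largest X C \in L) = (C \subset L).
Proof.
move=> [_ lowL] L0 DC; case: (largestP DC) => pC maxp.
apply/idP/subsetP => [Lp x Cx|sCL].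
  by apply: (lowL _ Lp); rewrite ?(Delta_elt DC Cx) // maxp // setU1r.
by case/setU1P: pC => [->|/sCL].
Qed.

Lemma low_rank C x : C \in low_chains X -> x \in C -> rank X x < dimn X.
Proof.
rewrite inE => /andP[DC ndC] Cx; rewrite ltn_neqAle (Delta_rank_le DC Cx) andbT.
by apply: contra ndC => /eqP <-; apply/ranksP; exists x.
Qed.

Lemma low_Delta C : C \in low_chains X -> C \in Delta X.
Proof. by rewrite inE => /andP[]. Qed.

Lemma lowP C : C \in Delta X -> (forall x, x \in C -> rank X x < dimn X) ->
  C \in low_chains X.
Proof.
move=> DC ltC; rewrite inE DC; apply/negP => /ranksP[x /ltC].
by move=> /[swap] <-; rewrite ltnn.
Qed.

Lemma low_largest C : 0 < dimn X -> C \in low_chains X -> rank X (largest X C) < dimn X.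
Proof.
move=> d_gt0 lowC; case: (largestP (low_Delta lowC)) => /setU1P[->|Cp] _.
  by rewrite rank_bot.
exact: (low_rank lowC Cp).
Qed.

Lemma face_Delta L : lower_set X L ->
  Delta (face_poset X L) = [set C in Delta X | C \subset L].
Proof.
move=> lL; have LX x := lower_elt lL (x := x); case: (lL) => /subsetP sL _.
have L1 : top X \notin L by apply/negP => /sL; rewrite !inE eqxx.
apply/setP => C; rewrite [RHS]inE.
apply/idP/andP => [|[/DeltaP[sC C0 C1 chC] sCL]].
  rewrite inE => /andP[/subsetP sC /is_chainP[_ chC]].
  have sCL : {subset C <= L}.
    by move=> x /sC; rewrite !inE /= negb_or => /andP[/andP[_ /negPf->]].
  split; last exact/subsetP.
  apply/DeltaP; split=> //; first by apply/subsetP => x /sCL/LX.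
    by apply/negP => /sC; rewrite !inE eqxx.
  by apply/negP => /sC; rewrite !inE eqxx orbT.
rewrite inE; apply/andP; split.
  apply/subsetP => x Cx; rewrite !inE (subsetP sCL x Cx) orbT andbT /=.
  by rewrite negb_or; apply/andP; split; [apply: contraNneq C0 | apply: contraNneq C1] => <-.
apply/is_chainP; split=> //=.
by apply: subset_trans sCL _; apply: subsetUr.
Qed.

Lemma face_rank L x : lower_set X L -> x \in L -> rank (face_poset X L) x = rank X x.
Proof.
move=> lL Lx; have Xx := lower_elt lL Lx; case: (lL) => /subsetP sL lowL.
have x1 : x != top X by have /setD1P[] := sL x Lx.
apply: eq_rank => //; apply/setP => z; rewrite !inE /=.
apply/andP/andP => -[zE /andP[neq le_zx]]; split; rewrite /lt /= ?neq ?le_zx //.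
  by case/orP: zE => [/eqP->|/(lower_elt lL)//]; apply: top_elt.
by rewrite (lowL x) ?orbT.
Qed.

End OnePoset.
End PosetRank.

(** * Sums of rank words over families of chains *)

Section ChainSums.
Variable T : finType.
Implicit Types (X Y : fposet T) (x y p s : T) (C G L : {set T}) (S : {set {set T}}).
Local Open Scope ring_scope.

(** With [n] the dimension and [S] all the chains this is the cd-index before the
    substitution of a - b for a. *)
Definition Psi n X S : abring := \sum_(C in S) ab_word n (ranks X C) va vb.

(** These are the chains of [face_poset X L], but without changing posets. *)
Definition chains_in X L : {set {set T}} := [set C in Delta X | C \subset L].

Lemma chains_inE X L C : (C \in chains_in X L) = (C \in Delta X) && (C \subset L).
Proof. by rewrite inE. Qed.

Lemma low_inE X C : (C \in low_chains X) = (C \in Delta X) && (dimn X \notin ranks X C).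
Proof. by rewrite inE. Qed.

Lemma eq_ranks X Y C : {in C, rank X =1 rank Y} -> ranks X C =i ranks Y C.
Proof.
move=> eq_r i; congr (i \in _); apply/eq_in_map => x; rewrite mem_enum.
exact: eq_r.
Qed.

Lemma eq_Psi n X Y S : (forall C, C \in S -> {in C, rank X =1 rank Y}) ->
  Psi n X S = Psi n Y S.
Proof.
move=> eq_r; apply: eq_bigr => C SC; apply: eq_ab_word => i _.
exact/eq_ranks/eq_r.
Qed.

Section OnePoset.
Variable X : fposet T.
Hypothesis posX : is_poset X.

Lemma Psi_drop n S :
  (forall C, C \in S -> {in C, forall x, (rank X x <= n)%N}) ->
  Psi n.+1 X S = Psi n X S * va.
Proof.
move=> small; rewrite /Psi mulr_suml; apply: eq_bigr => C /small leC.
rewrite ab_word_recr ifN //; apply/negP => /ranksP[x /leC + eq_x].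
by rewrite -eq_x ltnn.
Qed.

Lemma low_setE : low_chains X = [set C in Delta X | [forall x in C, (rank X x < dimn X)%N]].
Proof.
apply/setP => C; apply/idP/idP => [lowC|].
  rewrite inE (low_Delta lowC); apply/forall_inP => x Cx; exact: (low_rank posX lowC).
by rewrite inE => /andP[DC /forall_inP]; apply: lowP.
Qed.

Section Coatom.
Variable s : T.
Hypotheses (Cs : s \in coatoms X) (d_gt0 : (0 < dimn X)%N).

Lemma add_coatom G : G \in chains_in X (below X s :\ s) -> s |: G \in Delta X.
Proof.
rewrite inE => /andP[/DeltaP[/subsetP sG G0 G1 chG] /subsetP sGs].
have Xs := coatom_elt Cs.
have le_s x : x \in G -> le X x s by move/sGs; rewrite !inE => /and3P[].
apply/DeltaP; split.
- by apply/subsetP => x /setU1P[->|/sG].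
- by rewrite in_setU1 negb_or G0 eq_sym -(rank_gt0 posX) // coatom_rank // d_gt0.
- by rewrite in_setU1 negb_or G1 eq_sym coatom_neq_top.
move=> x y /setU1P[->|Gx] /setU1P[->|Gy]; last exact: chG.
- by rewrite (ple_refl posX).
- by rewrite (le_s y) ?orbT.
- by rewrite (le_s x).
Qed.

Lemma coatom_max C x : C \in Delta X -> s \in C -> x \in C -> le X x s.
Proof.
move=> DC Cs' Cx; have [//|le_sx] := orP (let: And4 _ _ _ h := DeltaP _ _ DC in h _ _ Cx Cs').
have [->|neq] := eqVneq x s; first by rewrite (ple_refl posX) ?coatom_elt.
have := rank_lt posX (coatom_elt Cs) (Delta_elt DC Cx).
rewrite /lt /= eq_sym neq le_sx coatom_rank // => /(_ isT).
by rewrite ltnNge (Delta_rank_le posX DC).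
Qed.

Lemma rem_coatom C : C \in Delta X -> s \in C -> C :\ s \in chains_in X (below X s :\ s).
Proof.
move=> DC Cs'; rewrite inE (sub_Delta _ DC) ?subD1set //; apply/subsetP => x.
by rewrite !inE => /andP[-> Cx]; rewrite (coatom_max DC) ?(Delta_elt DC).
Qed.

Lemma ab_word_add_coatom G (a b : abring) : G \in chains_in X (below X s :\ s) ->
  ab_word (dimn X) (ranks X (s |: G)) a b = ab_word (dimn X).-1 (ranks X G) a b * b.
Proof.
move=> GP; have rs : rank X s = dimn X by apply: coatom_rank.
case def_d: (dimn X) d_gt0 => [//|n] _; rewrite ab_word_recr /=.
rewrite ifT; last by apply/ranksP; exists s; rewrite ?setU11 // rs.
congr (_ * b); apply: eq_ab_word => i /andP[_ le_in].
apply/ranksP/ranksP => -[z zG def_i]; exists z; rewrite ?setU1r //.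
case/setU1P: zG => // zs; move: le_in.
by rewrite def_i zs rs def_d ltnn.
Qed.

(** Removing the coatom [s] is a bijection from the chains through [s] to the
    chains of the boundary of [s]. *)
Lemma Psi_coatom :
  \sum_(C in Delta X | s \in C) ab_word (dimn X) (ranks X C) va vb
  = Psi (dimn X).-1 X (chains_in X (below X s :\ s)) * vb.
Proof.
rewrite /Psi mulr_suml (reindex_onto (fun G => s |: G) (fun C => C :\ s)) /=.
  apply: eq_big => [G|G /andP[/andP[DG _] /eqP eqG]].
    apply/andP/idP => [[/andP[DG _] /eqP eqG]|GP].
      by rewrite -eqG; apply: rem_coatom; rewrite ?setU11.
    rewrite add_coatom // setU11 setU1K //.
    by apply/negP => Gs; move: GP; rewrite inE => /andP[_ /subsetP/(_ _ Gs)]; rewrite !inE eqxx.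
  by rewrite ab_word_add_coatom // -eqG; apply: rem_coatom; rewrite ?setU11.
by move=> C /andP[_ Cs']; rewrite setD1K.
Qed.

Lemma chains_below :
  chains_in X (below X s :\ s) = [set G in low_chains X | le X (largest X G) s].
Proof.
apply/setP => G; rewrite chains_inE [RHS]inE low_inE -andbA; apply: andb_id2l => DG.
have Xp := largest_elt posX DG.
have lowS := lower_strict_below posX (coatom_elt Cs) (coatom_neq_top posX Cs).
have b_in : bot X \in below X s :\ s.
  rewrite !inE (bot_elt posX) (ple_bot posX) ?coatom_elt // eq_sym.
  by rewrite -(rank_gt0 posX) ?coatom_elt // coatom_rank // d_gt0.
rewrite -(largest_lower posX lowS) // !inE Xp /=.
apply/andP/andP => [[neq le_ps]|[ndG le_ps]]; split=> //.
  apply: contra neq => /ranksP[x Gx dx].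
  apply/eqP/(ple_eq posX) => //; first exact: coatom_elt.
  have [_ /(_ x (setU1r _ Gx)) le_xp] := largestP posX DG.
  have Xx := Delta_elt DG Gx.
  have xs : x = s.
    have le_xs := ple_tr posX Xx Xp (coatom_elt Cs) le_xp le_ps.
    have [//|xs] := eqVneq x s.
    by have := lt_coatom posX Cs Xx le_xs xs; rewrite -dx ltnn.
  by rewrite -xs.
apply: contra ndG => /eqP ps; have [+ _] := largestP posX DG; rewrite ps.
case/setU1P=> [s0|Gs]; last by apply/ranksP; exists s; rewrite ?coatom_rank.
by move: d_gt0; rewrite -(coatom_rank Cs) s0 rank_bot.
Qed.

End Coatom.

(** Chains avoiding the top rank are counted with a last letter a; a chain that
    meets it passes through exactly one coatom. *)
Lemma Psi_split : (0 < dimn X)%N ->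
  Psi (dimn X) X (Delta X) =
    Psi (dimn X).-1 X (low_chains X) * va
    + \sum_(s in coatoms X) Psi (dimn X).-1 X (chains_in X (below X s :\ s)) * vb.
Proof.
move=> d_gt0; rewrite /Psi (big_setID (low_chains X)) /=.
have -> : Delta X :&: low_chains X = low_chains X.
  by apply/setIidPr/subsetP => C; apply: low_Delta.
rewrite -/(Psi _ _ _); congr (_ + _).
  rewrite -{1}(prednK d_gt0); apply: Psi_drop => C lowC x Cx.
  by rewrite -ltnS prednK // (low_rank posX lowC).
under [RHS]eq_bigr => s Cs do rewrite -/(Psi _ _ _) -Psi_coatom //.
rewrite (exchange_big_dep (mem (Delta X))) /=; last by move=> s C _ /andP[].
rewrite [RHS](big_setID (low_chains X)) /= [X in _ = X + _]big1 ?add0r.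
  apply: eq_bigr => C; rewrite inE low_inE => /andP[nlow DC].
  have {nlow} /ranksP[s Cs rs] : dimn X \in ranks X C by move: nlow; rewrite DC negbK.
  have sX : s \in coatoms X by rewrite coatomE ?(Delta_elt DC) // -rs.
  rewrite (big_pred1 s) // => s'; rewrite /= DC /=.
  apply/andP/eqP => [[s'X Cs']|->//].
  by apply: (Delta_comp_eq posX DC); rewrite // coatom_rank // -rs.
move=> C /setIP[_ lowC]; rewrite big_pred0 // => s; apply/negP => /and3P[Cs _ /(low_rank posX lowC)].
by rewrite coatom_rank // ltnn.
Qed.

(** Double counting of the pairs formed by a chain and a coatom above its largest
    element; [cnt] is the number of such coatoms. *)
Lemma sum_below (A : {set T}) (bd : T -> {set T}) : (0 < dimn X)%N ->
  {in A, forall s, lower_set X (bd s) /\ bot X \in bd s} ->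
  {in A, forall s, {in bd s, forall x, (rank X x < dimn X)%N}} ->
  (forall p, p \in elts X -> (rank X p < dimn X)%N ->
     #|[set s in coatoms X | le X p s]| = (2 + #|[set s in A | p \in bd s]|)%N) ->
  \sum_(s in coatoms X) Psi (dimn X).-1 X (chains_in X (below X s :\ s))
  = Psi (dimn X).-1 X (low_chains X) *+ 2
    + \sum_(s in A) Psi (dimn X).-1 X (chains_in X (bd s)).
Proof.
move=> d_gt0 lowA rkA cnt.
under eq_bigr => s Cs do rewrite chains_below // /Psi.
have -> : \sum_(s in A) Psi (dimn X).-1 X (chains_in X (bd s)) =
    \sum_(s in A) \sum_(C in [set C in low_chains X | largest X C \in bd s])
        ab_word (dimn X).-1 (ranks X C) va vb.
  apply: eq_bigr => s As; apply: eq_bigl => C; rewrite low_setE chains_inE [RHS]inE [in RHS]inE -andbA.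
  apply: andb_id2l => DC; have [lo b0] := lowA s As.
  rewrite (largest_lower posX lo) // andb_idl // => /subsetP sC.
  by apply/forall_inP => x /sC; apply: rkA.
rewrite (exchange_big_dep (mem (low_chains X))) /=; last first.
  by move=> s C _; rewrite inE => /andP[].
rewrite [X in _ + X](exchange_big_dep (mem (low_chains X))) /=; last first.
  by move=> s C _; rewrite inE => /andP[].
rewrite /Psi -sumrMnl -big_split /=; apply: eq_bigr => C lowC.
rewrite !sumr_const -mulrnDr; congr (_ *+ _).
transitivity #|[set s in coatoms X | le X (largest X C) s]|.
  by apply: eq_card => s; rewrite unfold_in /= [C \in _]inE lowC [RHS]inE.
rewrite cnt ?(largest_elt posX (low_Delta lowC)) ?low_largest //; congr (_ + _)%N.
by apply: eq_card => s; rewrite [RHS]unfold_in /= [C \in _]inE lowC [LHS]inE.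
Qed.

End OnePoset.

End ChainSums.

(** * Signed sums and the class of an ordinary coatom *)

Section SignedSums.
Variable T : finType.
Local Open Scope ring_scope.

Lemma eulerian_sum (X : fposet T) x y : eulerian X ->
  x \in elts X -> y \in elts X -> lt X x y ->
  \sum_(z in segment X x y) (-1) ^+ rank X z = 0 :> int.
Proof.
move=> [_ eulX] Xx Xy ltxy; have eq_card := eulX x y Xx Xy ltxy.
rewrite (big_setID [set z in segment X x y | odd (rank X z)]) /=.
rewrite (setIidPr _); last by apply/subsetP => z; rewrite inE => /andP[].
have -> : segment X x y :\: [set z in segment X x y | odd (rank X z)]
        = [set z in segment X x y | ~~ odd (rank X z)].
  by apply/setP => z; rewrite in_setD [z \in [set _ in _ | odd _]]in_set
    [RHS]in_set; case: (z \in segment X x y); rewrite /= ?andbT ?andbF.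
rewrite (eq_bigr (fun=> -1)) => [|z]; last first.
  by rewrite inE -signr_odd => /andP[_ ->]; rewrite expr1.
rewrite [X in _ + X](eq_bigr (fun=> 1)) => [|z]; last first.
  by rewrite inE -signr_odd => /andP[_ /negPf->]; rewrite expr0.
by rewrite !sumr_const eq_card mulNrn addNr.
Qed.

End SignedSums.

Lemma ltE (T : finType) (X : fposet T) x y : lt X x y = (x != y) && le X x y.
Proof. by []. Qed.

Lemma segmentE (T : finType) (X : fposet T) x y z :
  (z \in segment X x y) = [&& z \in elts X, le X x z & le X z y].
Proof. by rewrite inE. Qed.

Lemma belowE (T : finType) (X : fposet T) y z :
  (z \in below X y) = (z \in elts X) && le X z y.
Proof. by rewrite inE. Qed.

(** The setting of one ordinary coatom, gathered so that the lemmas below need a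
    single hypothesis. *)
Record ordinary_spec (T : finType) (X : fposet T) (P : T -> {set T}) (s : T) : Prop :=
  OrdinarySpec {
    ord_poset : is_poset X;
    ord_coatom : s \in coatoms X;
    ord_below : P s \subset below X s;
    ord_class : s \in P s;
    ord_closure :
      lower_closure X (P s :\ s) = (P s :\ s) :|: boundary (Gamma X P s);
    ord_disjoint : [disjoint P s :\ s & boundary (Gamma X P s)];
    ord_eulerian : eulerian (suspGamma X P s);
    ord_susp_coatom : s \in coatoms (suspGamma X P s);
    ord_rank : (rank (suspGamma X P s) (top X)).+1 = rank X (top X)
  }.

Section OrdinaryCoatom.
Variables (T : finType) (X : fposet T) (P : T -> {set T}) (s : T).
Implicit Types (x y z p : T) (C G : {set T}).
Local Notation L := (lower_closure X (P s :\ s)).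
Local Notation bd := (boundary (Gamma X P s)).
Local Notation Y := (suspGamma X P s).
Hypothesis ord : ordinary_spec X P s.
Local Open Scope ring_scope.

Let posX : is_poset X := ord_poset ord.
Let Cs : s \in coatoms X := ord_coatom ord.
Let sPs : P s \subset below X s := ord_below ord.
Let sP : s \in P s := ord_class ord.
Let defL := ord_closure ord.
Let disP := ord_disjoint ord.
Let eulY := ord_eulerian ord.
Let CYs : s \in coatoms Y := ord_susp_coatom ord.
Let rkY := ord_rank ord.
Lemma susp_poset : is_poset Y. Proof. by case: eulY => -[]. Qed.
Let posY := susp_poset.
Let Xs : s \in elts X := coatom_elt Cs.
Let s1 : s != top X := coatom_neq_top posX Cs.

Lemma Gamma_sub_below : L \subset below X s :\ s.
Proof.
apply/bigcupsP => c /setD1P[cs /(subsetP sPs) cbs]; apply/subsetP => x xc.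
have [_ lowb] := lower_strict_below posX Xs s1.
by move: xc; rewrite [x \in below X c]inE => /andP[Xx xc]; apply: lowb xc; rewrite // in_setD1 cs.
Qed.

Lemma Gamma_lower : lower_set X L.
Proof.
apply: (lower_closure_lower posX); apply: subset_trans (proj1 (lower_below posX Xs s1)).
exact: subset_trans (subD1set _ _) sPs.
Qed.

Lemma coatom_notin_Gamma : s \notin L.
Proof. by apply/negP => /(subsetP Gamma_sub_below); rewrite !inE eqxx. Qed.

Lemma face_neq_coatom x : x \in L -> x != s.
Proof. by move=> Lx; apply/eqP => xs; move: Lx; rewrite xs (negPf coatom_notin_Gamma). Qed.

Lemma top_notin_Gamma : top X \notin L.
Proof. by apply/negP => /(subsetP (proj1 Gamma_lower)); rewrite !inE eqxx. Qed.

Lemma bd_sub_Gamma : bd \subset L.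
Proof. by rewrite defL subsetUr. Qed.

Lemma coatom_notin_bd : s \notin bd.
Proof. by apply/negP => /(subsetP bd_sub_Gamma); apply/negP; apply: coatom_notin_Gamma. Qed.

Lemma bd_lower : lower_set X bd.
Proof.
split; first exact: subset_trans bd_sub_Gamma (proj1 Gamma_lower).
move=> x /[dup] /(subsetP bd_sub_Gamma) Lx /bigcupP[c bc] + z Xz zx.
rewrite [x \in _]inE => /andP[_ /= xc]; apply/bigcupP; exists c => //.
have Lz : z \in L by apply: (proj2 Gamma_lower x Lx).
have Xx := lower_elt Gamma_lower Lx.
have Xc : c \in elts X.
  move: bc; rewrite inE => /andP[+ _]; rewrite /= !inE => /orP[/eqP->|/(lower_elt Gamma_lower)//].
  exact: top_elt.
by rewrite inE /= !inE Lz orbT /= (ple_tr posX Xz Xx Xc).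
Qed.

Lemma susp_elt x : (x \in elts Y) = [|| x == s, x == top X | x \in L].
Proof. by rewrite !inE. Qed.

Lemma Gamma_susp x : x \in L -> x \in elts Y.
Proof. by rewrite susp_elt => ->; rewrite !orbT. Qed.

(** The semisuspension changes the order only at the added coatom, which does not
    belong to the lower set generated by the class. *)
Lemma le_suspE : {in L &, le Y =2 le X}.
Proof.
move=> x y Lx Ly; rewrite /=.
rewrite ifN; last by apply: face_neq_coatom.
by rewrite ifN //; apply: face_neq_coatom.
Qed.

Lemma le_susp_coatom x : le Y x s = (x == s) || (x \in bd).
Proof. by rewrite /= eqxx. Qed.

Lemma le_susp_coatom_face y : y \in L -> le Y s y = false.
Proof.
move=> Ly; rewrite /= ifN; last by apply: face_neq_coatom.
by rewrite eqxx; apply/eqP => y1; move: Ly; rewrite y1 (negPf top_notin_Gamma).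
Qed.

Lemma le_susp_top_face y : y \in L -> le Y (top X) y = false.
Proof.
move=> Ly; apply/negP => le1y; have Yy := Gamma_susp Ly.
have : y = top X by apply: (ple_eq posY); rewrite ?(ple_top posY) ?(top_elt posY).
by move=> y1; move: Ly; rewrite y1 (negPf top_notin_Gamma).
Qed.

Lemma rank_suspE x : x \in L -> rank Y x = rank X x.
Proof.
move=> Lx; have [_ lowL] := Gamma_lower.
have eqS : [set z in elts Y | lt Y z x] = [set z in elts X | lt X z x].
  apply/setP => z; rewrite inE [RHS]inE susp_elt; apply/andP/andP.
    case=> /or3P[/eqP->|/eqP->|Lz]; rewrite ltE => /andP[neq]; rewrite ?le_susp_coatom_face ?le_susp_top_face //.
    by rewrite le_suspE // => zx; rewrite (lower_elt Gamma_lower Lz) ltE neq.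
  case=> Xz /andP[neq zx]; have Lz := lowL x Lx z Xz zx.
  by rewrite Lz !orbT ltE neq le_suspE.
apply: eq_rank => // y z; rewrite eqS inE => /andP[Xy /andP[_ yx]].
rewrite inE => /andP[Xz /andP[_ zx]].
by apply: le_suspE; apply: (lowL x).
Qed.

(** The boundary of the near-Eulerian poset is the boundary of the added coatom in
    the semisuspension; when that coatom is initial it is S-partitionable. *)
Lemma below_susp_coatom : below Y s :\ s = bd.
Proof.
apply/setP => x; rewrite in_setD1 [x \in below _ _]inE le_susp_coatom susp_elt.
have bL := subsetP bd_sub_Gamma x.
have [->|neq] := eqVneq x s; first by rewrite (negPf coatom_notin_bd).
by rewrite /= andb_idl // => /bL->; rewrite orbT.
Qed.

Lemma below_susp_coatomU : below Y s = s |: bd.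
Proof. by rewrite -below_susp_coatom setD1K // inE (coatom_elt CYs) (ple_refl posY) ?coatom_elt. Qed.

Lemma dimn_susp : (dimn Y).+1 = dimn X.
Proof.
rewrite /dimn -rkY -[top Y]/(top X) prednK //.
by have := rank_lt_top posY (coatom_elt CYs); rewrite s1; case: (rank Y (top X)).
Qed.

Lemma dimn_susp_gt0 : (0 < dimn X)%N -> (0 < dimn Y)%N.
Proof.
move=> d_gt0; rewrite -(coatom_rank CYs) (rank_gt0 posY) ?(coatom_elt CYs) //.
by rewrite -[bot _]/(bot X) -(rank_gt0 posX) // coatom_rank.
Qed.

Lemma bd_bot : (0 < dimn X)%N -> bot X \in bd.
Proof.
move/dimn_susp_gt0 => d_gt0; rewrite -below_susp_coatom in_setD1 eq_sym.
rewrite -[bot X]/(bot Y) -(rank_gt0 posY) ?coatom_elt // coatom_rank // d_gt0 /=.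
by rewrite inE (bot_elt posY) (ple_bot posY) ?coatom_elt.
Qed.

Lemma bd_rank x : x \in bd -> (rank X x < dimn Y)%N.
Proof.
move=> bx; rewrite -rank_suspE ?(subsetP bd_sub_Gamma) //.
have : x \in below Y s :\ s by rewrite below_susp_coatom.
by rewrite in_setD1 inE => /and3P[neq Yx xs]; apply: (lt_coatom posY CYs).
Qed.

Lemma Gamma_rank x : x \in L -> (rank X x < dimn X)%N.
Proof.
move/(subsetP Gamma_sub_below); rewrite in_setD1 inE => /and3P[neq Xx xs].
exact: (lt_coatom posX Cs).
Qed.

Lemma Delta_suspE C : s \notin C -> (C \in Delta Y) = (C \in chains_in X L).
Proof.
move=> nCs; rewrite chains_inE; apply/DeltaP/andP => [[sC C0 C1 chC]|[/DeltaP[sC C0 C1 chC] sL]].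
  have sL : C \subset L.
    apply/subsetP => x Cx; have := subsetP sC x Cx; rewrite susp_elt.
    by case/or3P=> // /eqP xE; [move: nCs | move: C1]; rewrite /= -xE Cx.
  split=> //; apply/DeltaP; split=> //.
    by apply/subsetP => x /(subsetP sL)/(lower_elt Gamma_lower).
  by move=> x y Cx Cy; rewrite -!le_suspE ?(subsetP sL) //; apply: chC.
split=> //; first by apply/subsetP => x /(subsetP sL)/Gamma_susp.
by move=> x y Cx Cy; rewrite !le_suspE ?(subsetP sL) //; apply: chC.
Qed.

Lemma chains_bdE : chains_in Y bd = chains_in X bd.
Proof.
apply/setP => C; rewrite !chains_inE; apply/andP/andP => -[DC sC]; split=> //.
  move: DC; rewrite Delta_suspE ?chains_inE => [/andP[]//|].
  by apply: contra coatom_notin_bd => /(subsetP sC).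
rewrite Delta_suspE ?chains_inE ?DC ?(subset_trans sC) ?bd_sub_Gamma //.
by apply: contra coatom_notin_bd => /(subsetP sC).
Qed.

Lemma ranks_bd C : C \in chains_in X bd -> {in C, rank Y =1 rank X}.
Proof.
rewrite chains_inE => /andP[_ /subsetP sC] x /sC /(subsetP bd_sub_Gamma).
exact: rank_suspE.
Qed.

(** By construction of the bottom chains, these index the blocks that correspond
    to the coatom [s]. *)
Definition class_chains : {set {set T}} := [set G in low_chains X | largest X G \in P s].

(** A chain of the semisuspension passes through the added coatom, lies in the
    boundary, or has its largest element in the class of [s]; the last kind does
    not involve the added coatom and is a chain of [X]. *)
Lemma class_chainsE : (0 < dimn X)%N ->
  class_chains = [set C in Delta Y | (s \notin C) && ~~ (C \subset bd)].
Proof.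
move=> d_gt0; have b0 := bd_bot d_gt0; have L0 := subsetP bd_sub_Gamma _ b0.
apply/setP => C; rewrite [LHS]inE [RHS]inE; apply/andP/and3P.
  case=> lowC Pp; have DC := low_Delta lowC.
  have ps : largest X C != s.
    by apply: contraTneq (low_largest posX d_gt0 lowC) => ->; rewrite coatom_rank // ltnn.
  have pD : largest X C \in P s :\ s by rewrite in_setD1 ps.
  have sCL : C \subset L by rewrite -(largest_lower posX Gamma_lower) // defL inE pD.
  have nCs : s \notin C by apply: contra coatom_notin_Gamma => /(subsetP sCL).
  rewrite Delta_suspE // chains_inE DC sCL -(largest_lower posX bd_lower) //; split=> //.
  by apply/negP => pb; have /pred0P/(_ (largest X C)) := disP; rewrite /= pD pb.
case=> DC nCs nCb; move: DC; rewrite Delta_suspE // chains_inE => /andP[DC sCL].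
have : largest X C \in L by rewrite (largest_lower posX Gamma_lower).
rewrite defL inE (largest_lower posX bd_lower) // (negPf nCb) orbF in_setD1 => /andP[_ ->].
by split=> //; apply: lowP => // x /(subsetP sCL)/Gamma_rank.
Qed.

(** The chains of the semisuspension through the added coatom and those of the
    boundary together have the sum of the boundary times a + b. *)
Lemma Psi_class n : dimn X = n.+2 ->
  Psi n.+1 X class_chains
  = Psi n.+1 Y (Delta Y) - Psi n X (chains_in X bd) * (va + vb).
Proof.
move=> dX; have dY : dimn Y = n.+1 by move: dimn_susp; rewrite dX => -[].
have dY0 : (0 < dimn Y)%N by rewrite dY.
have d_gt0 : (0 < dimn X)%N by rewrite dX.
apply/esym/eqP; rewrite subr_eq mulrDr; apply/eqP.
(* the term in b counts the chains through [s], the one in a those of [bd] *)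
have -> : Psi n X (chains_in X bd) = Psi n Y (chains_in Y bd).
  by rewrite chains_bdE; apply: eq_Psi => C Cb x Cx; rewrite (ranks_bd Cb).
have <- : \sum_(C in Delta Y | s \in C) ab_word n.+1 (ranks Y C) va vb
       = Psi n Y (chains_in Y bd) * vb.
  by have := Psi_coatom posY CYs dY0; rewrite below_susp_coatom dY; apply.
rewrite -Psi_drop; last first.
  move=> C; rewrite chains_bdE chains_inE => /andP[_ /subsetP sC] x /sC bx.
  by rewrite rank_suspE ?(subsetP bd_sub_Gamma) // -ltnS -dY bd_rank.
rewrite class_chainsE // [in LHS]/Psi (bigID (fun C => s \in C)) /=.
rewrite [X in _ + X = _](bigID (fun C => C \subset bd)) /=.
rewrite [RHS]addrC [X in _ = X + _]addrC -[RHS]addrA; congr (_ + (_ + _)).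
- apply: eq_bigl => C; rewrite chains_inE -andbA; congr (_ && _).
  by rewrite andb_idl // => sC; apply: contra coatom_notin_bd => /(subsetP sC).
- have -> : Psi n.+1 X [set C in Delta Y | (s \notin C) && ~~ (C \subset bd)]
          = Psi n.+1 Y [set C in Delta Y | (s \notin C) && ~~ (C \subset bd)].
    apply: eq_Psi => C; rewrite inE => /and3P[DC nCs _] x Cx.
    by move: DC; rewrite Delta_suspE // chains_inE => /andP[_ /subsetP/(_ x Cx)/rank_suspE].
  by apply: eq_bigl => C; rewrite [RHS]inE andbA.
Qed.

(** Let [p] be in the lower set generated by the class.  Subtract from the Eulerian
    relation of the semisuspension from [p] to the top the one from [p] to the
    added coatom, an empty sum unless [p] is in the boundary: what is left is the
    sum over the class without [s], together with the term of the top, which has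
    the sign of [s] in [X].  Elsewhere only the term of [s] can occur. *)
Lemma signed_class p : p \in elts X -> p != s -> p != top X ->
  \sum_(z in P s | le X p z) (-1) ^+ rank X z
  = (if [&& le X p s, p \notin P s & p \notin bd] then (-1) ^+ dimn X else 0) :> int.
Proof.
move=> Xp neq_ps neq_p1; have [_ lowL] := Gamma_lower.
have [le_ps|nle] := boolP (le X p s); last first.
  rewrite big_pred0 // => z; apply/negP => /andP[/(subsetP sPs)].
  rewrite inE => /andP[Xz zs] pz; case/negP: nle.
  exact: (ple_tr posX Xp Xz Xs pz zs).
rewrite (bigD1 s) /=; last by rewrite sP.
rewrite (coatom_rank Cs).
rewrite (eq_bigl (fun z => z \in [set z in P s :\ s | le X p z])); last first.
  by move=> z; rewrite [RHS]inE in_setD1 -andbA andbC -andbA; do !bool_congr.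
have sPL z : z \in P s :\ s -> z \in L by rewrite defL in_setU => ->.
have : (p \in L) = (p \in P s) || (p \in bd) by rewrite defL in_setU in_setD1 neq_ps.
have [Lp /esym|nLp /esym/negbT] := boolP (p \in L); last first.
  rewrite negb_or => /andP[-> ->]; rewrite big_pred0 ?addr0 // => z.
  apply/negP; rewrite inE => /andP[/sPL Lz pz]; case/negP: nLp.
  exact: lowL pz.
rewrite -negb_or => ->; rewrite /=.
have Yp := Gamma_susp Lp; have Yt : top X \in elts Y := top_elt posY.
have ltp1 : lt Y p (top X) by rewrite ltE neq_p1 (ple_top posY Yp).
have := eulerian_sum eulY Yp Yt ltp1.
rewrite (big_setID (below Y s)) /=.
have -> : \sum_(z in segment Y p (top X) :&: below Y s) (-1) ^+ rank Y z = 0 :> int.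
  have [le_psY|nle] := boolP (le Y p s).
    rewrite -(eulerian_sum eulY Yp (coatom_elt CYs) _); last by rewrite ltE neq_ps.
    apply: eq_bigl => z; rewrite in_setI !segmentE belowE.
    have [Yz|//] := boolP (z \in elts Y).
    by rewrite (ple_top posY Yz) /= andbT.
  rewrite big_pred0 // => z; apply/negP; rewrite in_setI !segmentE belowE.
  case/andP=> /and3P[Yz pz _] /andP[_ zs]; case/negP: nle.
  exact: (ple_tr posY Yp Yz (coatom_elt CYs) pz zs).
have -> : segment Y p (top X) :\: below Y s = top X |: [set z in P s :\ s | le X p z].
  apply/setP => z; rewrite in_setD in_setU1 segmentE below_susp_coatomU in_setU1.
  rewrite susp_elt [in RHS]inE in_setD1; have [->|z1] := eqVneq z (top X).
    rewrite orbT (ple_top posY Yp) (ple_refl posY) // !andbT eq_sym (negPf s1).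
    by apply/negP => /(subsetP bd_sub_Gamma); rewrite (negPf top_notin_Gamma).
  have [->|zs] := eqVneq z s; first by rewrite ?andbF.
  rewrite !orFb defL in_setU in_setD1 zs !andTb.
  have [bz|nbz] := boolP (z \in bd); rewrite ?orbT ?orbF ?andFb ?andTb.
    apply/esym/negP => /andP[Pz _].
    by have /pred0P/(_ z) := disP; rewrite /= in_setD1 zs Pz bz.
  apply: andb_id2l => Pz.
  have Lz : z \in L by apply: sPL; rewrite in_setD1 zs.
  by rewrite le_suspE // (ple_top posY (Gamma_susp Lz)) andbT.
rewrite big_setU1 /=; last first.
  by rewrite inE in_setD1; apply/negP => /andP[/andP[_ /(subsetP sPs)]];
     have /subsetP := proj1 (lower_below posX Xs s1) => h /h; rewrite !inE eqxx.
rewrite add0r => eq0; rewrite -[RHS]eq0 -dimn_susp.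
have -> : rank Y (top X) = (dimn Y).+1 by rewrite dimn_susp /dimn -rkY.
congr (_ + _); apply: eq_bigr => z; rewrite inE => /andP[/sPL Lz _].
by rewrite rank_suspE.
Qed.

End OrdinaryCoatom.

(** * The coatom count and positivity of the cd-index *)

Section SPartitions.
Variable T : finType.
Implicit Types (X : fposet T) (P : T -> {set T}) (x y z p s : T) (C G : {set T}).

Local Notation bdry X P s := (boundary (Gamma X P s)).

Section CoatomPartition.
Variables (X : fposet T) (P : T -> {set T}).
Hypotheses (posX : is_poset X) (parP : coatom_partition X P).

Lemma class_below s : s \in coatoms X -> P s \subset below X s.
Proof. by case: parP => _ _; apply. Qed.

Lemma class_exists x : x \in elts X -> x != top X ->
  exists2 s, s \in coatoms X & x \in P s.
Proof.
move=> Xx x1; case: parP => partP _ _.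
have : x \in elts X :\ top X by rewrite in_setD1 x1.
by rewrite -(cover_partition partP) => /bigcupP[_ /imsetP[s Cs ->] Px]; exists s.
Qed.

Lemma class_unique x s s' : s \in coatoms X -> s' \in coatoms X ->
  x \in P s -> x \in P s' -> s = s'.
Proof.
move=> Cs Cs' Px Px'; case: parP => partP injP _.
apply: injP => //; have /trivIsetP tI := partition_trivIset partP.
apply/eqP; apply: contraT => neq.
have /pred0P/(_ x) := tI _ _ (imset_f P Cs) (imset_f P Cs') neq.
by rewrite /= Px Px'.
Qed.

(** A coatom lies in some class, and the only coatom below a coatom is itself. *)
Lemma class_coatom s : s \in coatoms X -> s \in P s.
Proof.
move=> Cs; have Xs := coatom_elt Cs.
have [s' Cs' Ps'] := class_exists Xs (coatom_neq_top posX Cs).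
have [ss'|neq] := eqVneq s s'; first by rewrite {2}ss'.
have := subsetP (class_below Cs') _ Ps'; rewrite belowE => /andP[_ le_ss'].
by have := lt_coatom posX Cs' Xs le_ss' neq; rewrite coatom_rank // ltnn.
Qed.

End CoatomPartition.

Lemma ordinary_coatom X P s : s \in ordinary X P -> s \in coatoms X.
Proof. by rewrite /ordinary in_setD => /andP[]. Qed.

(** The data of an S-partition of a poset of rank at least two, without the
    recursive conditions. *)
Record step_spec X P : Prop := StepSpec {
  step_eulerian : eulerian X;
  step_rank : 2 <= rank X (top X);
  step_partition : coatom_partition X P;
  step_initial : exists s1, initials X P = [set s1];
  step_terminal : exists st, terminals X P = [set st];
  step_ordinary : {in ordinary X P, forall s, ordinary_spec X P s}
}.

Lemma S_partition_eulerian X P : S_partition X P -> eulerian X.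
Proof. by case. Qed.

Lemma S_partition_step_spec X P :
  S_partition X P -> 2 <= rank X (top X) -> step_spec X P.
Proof.
case=> [{}X {}P _ -> //|{}X {}P s1 st P1 Q eulX r2 cpX ini _ _ ter _ _ clo dis SY rkY iniY _].
split=> //; [by exists s1 | by exists st | move=> s os].
have posX : is_poset X by case: eulX => -[].
have Cs := ordinary_coatom os; split=> //.
- exact: (class_below cpX Cs).
- exact: (class_coatom posX cpX Cs).
- exact: clo.
- exact: dis.
- exact: S_partition_eulerian (SY s os).
- by have := iniY s os; rewrite inE => /andP[].
- exact: rkY.
Qed.

Section Step.
Variables (X : fposet T) (P : T -> {set T}).
Hypothesis SX : step_spec X P.
Local Open Scope ring_scope.

Lemma step_poset : is_poset X. Proof. by case: (step_eulerian SX) => -[]. Qed.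
Let posX := step_poset.
Let parP := step_partition SX.

Lemma step_dimn_gt0 : (0 < dimn X)%N.
Proof. by rewrite /dimn; case: (rank X (top X)) (step_rank SX) => // -[]. Qed.
Let d_gt0 := step_dimn_gt0.

Lemma step_dimn : rank X (top X) = (dimn X).+1.
Proof. by rewrite /dimn prednK //; apply: ltnW (step_rank SX). Qed.

Lemma coatom_cases s : s \in coatoms X ->
  [\/ P s = below X s, P s = [set s] | s \in ordinary X P].
Proof.
move=> Cs; have [os|] := boolP (s \in ordinary X P); first by constructor 3.
rewrite /ordinary in_setD Cs andbT negbK in_setU !inE.
have -> : (s \in elts X) && ((rank X s).+1 == rank X (top X)).
  by move: Cs; rewrite inE.
by case/orP=> /eqP; [constructor 1 | constructor 2].
Qed.

(** For an initial coatom this is the Eulerian relation of the interval below it;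
    the class of a terminal coatom is a single point. *)
Lemma signed_coatom p s : s \in coatoms X -> p \in elts X -> (rank X p < dimn X)%N ->
  \sum_(z in P s | le X p z) (-1) ^+ rank X z
  = (if [&& le X p s, p \notin P s & ~~ ((s \in ordinary X P) && (p \in bdry X P s))]
     then (-1) ^+ dimn X else 0) :> int.
Proof.
move=> Cs Xp ltp; have Xs := coatom_elt Cs.
have ps : p != s by apply: contraTneq ltp => ->; rewrite coatom_rank // ltnn.
have p1 : p != top X.
  by rewrite -(rank_lt_top posX) // step_dimn ltnS ltnW.
have [os|nos] := boolP (s \in ordinary X P).
  exact: signed_class (step_ordinary SX os) _ Xp ps p1.
case: (coatom_cases Cs) => [Ps|Ps|]; last by rewrite (negPf nos).
- rewrite Ps belowE Xp /=; case: ifP => [|_]; first by case: (le X p s).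
  have [le_ps|nle] := boolP (le X p s); last first.
    rewrite big_pred0 // => z; apply/negP => /andP[]; rewrite belowE => /andP[Xz zs] pz.
    by case/negP: nle; apply: (ple_tr posX Xp Xz Xs pz zs).
  rewrite -(eulerian_sum (step_eulerian SX) Xp Xs _) ?ltE ?ps //.
  by apply: eq_bigl => z; rewrite segmentE belowE -andbA [le X z s && _]andbC.
- rewrite Ps in_set1 (negPf ps) !andbT.
  case: ifP => le_ps.
    rewrite (big_pred1 s) ?coatom_rank // => z /=; rewrite in_set1.
    by case: eqP => // ->.
  by rewrite big_pred0 // => z; rewrite in_set1; case: eqP => // ->.
Qed.

(** Above [p] there are the coatom whose class contains [p], the ordinary coatoms
    with [p] in their boundary, and the remaining ones.  In the Eulerian relation
    of the interval from [p] to the top, grouped by classes, only the top and the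
    remaining coatoms have a nonzero signed sum, and their signs are opposite:
    exactly one coatom remains. *)
Lemma coatom_count p : p \in elts X -> (rank X p < dimn X)%N ->
  #|[set s in coatoms X | le X p s]|
  = (2 + #|[set s in ordinary X P | p \in bdry X P s]|)%N.
Proof.
move=> Xp ltp.
have p1 : p != top X.
  by rewrite -(rank_lt_top posX) // step_dimn ltnS ltnW.
set A := [set s in coatoms X | le X p s].
set Q := [set s | p \in P s].
set D := [set s in ordinary X P | p \in bdry X P s].
have sDA : D \subset A :\: Q.
  apply/subsetP => s; rewrite inE => /andP[os bp].
  have spec := step_ordinary SX os; have Cs := ordinary_coatom os.
  have Lp := subsetP (bd_sub_Gamma spec) _ bp.
  have := subsetP (Gamma_sub_below spec) _ Lp; rewrite in_setD1 belowE => /and3P[ps _ le_ps].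
  rewrite in_setD [s \in A]inE [s \in Q]inE Cs le_ps !andbT.
  apply/negP => Pp; have /pred0P/(_ p) := ord_disjoint spec.
  by rewrite /= in_setD1 ps Pp bp.
have cardAQ : #|A :&: Q| = 1%N.
  have [s0 Cs0 Pp] := class_exists parP Xp p1.
  apply/eqP/cards1P; exists s0; apply/setP => s; rewrite in_set1 in_setI.
  apply/andP/eqP => [[]|->].
    rewrite inE => /andP[Cs _]; rewrite inE => Pp'.
    exact: (class_unique parP Cs Cs0 Pp' Pp).
  have := subsetP (class_below parP Cs0) _ Pp; rewrite belowE => /andP[_ le_p].
  by rewrite [s0 \in A]inE [s0 \in Q]inE Cs0 le_p.
have cardR : #|(A :\: Q) :\: D| = 1%N.
  have := eulerian_sum (step_eulerian SX) Xp (top_elt posX).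
  rewrite ltE p1 (ple_top posX Xp) => /(_ isT).
  (* the proper part of the interval is cut into the classes of the coatoms *)
  rewrite (big_setD1 (top X)) /=; last first.
    by rewrite segmentE (top_elt posX) (ple_top posX Xp) (ple_refl posX) ?top_elt.
  rewrite (eq_bigl (fun z => (z \in elts X :\ top X) && le X p z)); last first.
    move=> z; rewrite in_setD1 segmentE in_setD1 -andbA; congr (_ && _).
    by case Xz: (z \in elts X); rewrite //= (ple_top posX Xz) andbT.
  have [partP injP _] := parP.
  rewrite (set_partition_big_cond _ partP) big_imset //=.
  rewrite (eq_bigr _ (fun s Cs => signed_coatom Cs Xp ltp)) -big_mkcondr /=.
  rewrite sumr_const step_dimn exprS mulN1r -mulr_natr addrC => /eqP.
  rewrite subr_eq0 -[X in _ == X]mulr1 => /eqP/(mulfI _) eq1.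
  have /eqP : #|[pred s in coatoms X | [&& le X p s, p \notin P s & ~~ ((s \in ordinary X P) && (p \in bdry X P s))]]|%:R = 1%:R :> int.
    by apply: eq1; rewrite expf_neq0 // oppr_eq0 oner_eq0.
  rewrite eqr_nat => /eqP <-; apply: eq_card => s.
  rewrite in_setD in_setD [s \in A]inE [s \in Q]inE [s \in D]inE.
  rewrite [RHS]inE /=; case: (s \in coatoms X); rewrite /= ?andbF //.
  by case: (le X p s); rewrite /= ?andbF // andbT andbC.
rewrite -(cardsID Q A) cardAQ -(cardsID D (A :\: Q)) (setIidPr sDA) cardR.
by rewrite addnCA addnC.
Qed.

Lemma class_chains_below s : s \in coatoms X -> P s = below X s ->
  class_chains X P s = chains_in X (below X s :\ s).
Proof.
move=> Cs Ps; rewrite (chains_below posX Cs d_gt0); apply/setP => C.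
rewrite [LHS]inE [RHS]inE; apply: andb_id2l => lowC.
by rewrite Ps belowE (largest_elt posX (low_Delta lowC)).
Qed.

Lemma class_chains_terminal s : s \in coatoms X -> P s = [set s] ->
  class_chains X P s = set0.
Proof.
move=> Cs Ps; apply/setP => C; rewrite [RHS]inE; apply/negP.
rewrite inE Ps in_set1 => /andP[lowC /eqP ps].
by have := low_largest posX d_gt0 lowC; rewrite ps coatom_rank // ltnn.
Qed.

Lemma Psi_low n : Psi n X (low_chains X) = \sum_(s in coatoms X) Psi n X (class_chains X P s).
Proof.
rewrite /Psi [RHS](exchange_big_dep (mem (low_chains X))) /=; last first.
  by move=> s C _; rewrite inE => /andP[].
apply: eq_bigr => C lowC; have DC := low_Delta lowC.
have [s0 Cs0 Pp] := class_exists parP (largest_elt posX DC) (largest_neq_top posX d_gt0 DC).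
rewrite (big_pred1 s0) // => s /=; rewrite [C \in _]inE lowC /=.
apply/andP/eqP => [[Cs Pp']|->//].
exact: (class_unique parP Cs Cs0 Pp' Pp).
Qed.

Lemma step_algebra (R : nzRingType) (I : finType) (A : {pred I}) (f g : I -> R) (a b l p : R) :
  l - p = \sum_(i in A) f i ->
  l * a + (l *+ 2 + \sum_(i in A) g i) * b - p * (a + b + b)
  = \sum_(i in A) (f i * (a + b + b) + g i * b).
Proof.
move=> eq_lp; rewrite big_split -!mulr_suml -eq_lp.
rewrite mulrBl !mulrDr mulr2n !mulrDl !addrA.
by rewrite [LHS]addrAC.
Qed.

(** The coatom count contributes twice every chain avoiding the top rank, and such
    chains are distributed among the classes.  The class of the initial coatom
    gives the subtracted term and that of the terminal coatom contains none. *)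
Lemma Psi_step s1 : s1 \in initials X P ->
  Psi (dimn X) X (Delta X) - Psi (dimn X).-1 X (chains_in X (below X s1 :\ s1)) * cwt
  = \sum_(s in ordinary X P)
      (Psi (dimn X).-1 X (class_chains X P s) * cwt
       + Psi (dimn X).-1 X (chains_in X (bdry X P s)) * vb).
Proof.
move=> ini1; have [Cs1 Ps1] : s1 \in coatoms X /\ P s1 = below X s1.
  by move: ini1; rewrite inE => /andP[C1 /eqP].
have nos1 : s1 \notin ordinary X P by rewrite in_setD in_setU ini1.
rewrite (Psi_split posX d_gt0) -mulr_suml.
rewrite (sum_below posX (A := ordinary X P) (bd := fun s => bdry X P s) d_gt0); first last.
- exact: coatom_count.
- move=> s os x bx; apply: ltn_trans (bd_rank (step_ordinary SX os) bx) _.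
  by rewrite -(dimn_susp (step_ordinary SX os)).
- by move=> s os; have spec := step_ordinary SX os; rewrite bd_bot //; split=> //; apply: bd_lower.
apply: step_algebra.
rewrite Psi_low (bigD1 s1) //= class_chains_below // addrAC subrr add0r.
rewrite (bigID (mem (ordinary X P))) /= [X in _ + X]big1 ?addr0.
  apply: eq_bigl => s; rewrite -andbA; apply/and3P/idP => [[]//|os].
  split=> //; first exact: ordinary_coatom os.
  by apply: contraNneq nos1 => <-.
move=> s /andP[/andP[Cs neq] nos].
have [Ps|Ps|] := coatom_cases Cs; last by rewrite (negPf nos).
  case: (step_initial SX) => s0 ini; have : s \in initials X P by rewrite inE -Ps eqxx andbT.
  by move: ini1 neq; rewrite ini !in_set1 => /eqP-> /negPf->.
by rewrite class_chains_terminal // /Psi big_set0.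
Qed.

End Step.

Local Open Scope ring_scope.

Lemma Psi_rank1 X : is_poset X -> dimn X = 0%N -> Psi 0 X (Delta X) = 1.
Proof.
move=> posX d0; have -> : Delta X = [set set0].
  apply/setP => C; rewrite in_set1; apply/idP/eqP => [DC|->].
    apply/setP => x; rewrite in_set0; apply/negP => Cx.
    have := Delta_rank_le posX DC Cx; rewrite d0 leqNgt.
    by rewrite (Delta_rank_gt0 posX DC).
  by apply/DeltaP; split; rewrite ?sub0set ?inE // => x y; rewrite inE.
by rewrite /Psi big_set1 /ab_word big_geq.
Qed.

Lemma Psi_bd X P s n : step_spec X P -> s \in ordinary X P -> dimn X = n.+2 ->
  Psi n.+1 X (chains_in X (bdry X P s)) = Psi n X (chains_in X (bdry X P s)) * va.
Proof.
move=> SX os dX; have spec := step_ordinary SX os.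
apply: Psi_drop => C; rewrite chains_inE => /andP[_ /subsetP sC] x /sC /(bd_rank spec).
by have := dimn_susp spec; rewrite dX => -[->].
Qed.

(** With [l] the sum over the chains of a class and [p] the sum over its boundary,
    the summand of [Psi_step] is a multiple of c plus a multiple of d. *)
Lemma cd_algebra (R : nzRingType) (l p a b : R) :
  l * (a + b + b) + p * a * b
  = (l - p * b) * (a + b + b) + p * (a * b + b * a + b * b + b * b).
Proof.
rewrite mulrBl -[RHS]addrA; congr (_ + _).
apply/eqP; rewrite eq_sym addrC subr_eq -!mulrA -mulrDr.
by rewrite !mulrDr !addrA.
Qed.

(** The second part is stronger than positivity of the cd-index: the boundary of
    the initial coatom splits off.  The induction applies it to semisuspensions,
    whose initial coatom is the added one. *)
Definition cd_positive X P : Prop :=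
  cdsum (dimn X) (Psi (dimn X) X (Delta X)) /\
  ((2 <= rank X (top X))%N -> forall s1, s1 \in initials X P ->
     cdsum (dimn X).-1 (Psi (dimn X).-1 X (chains_in X (below X s1 :\ s1))) /\
     cdsum (dimn X) (Psi (dimn X) X (Delta X)
       - Psi (dimn X).-1 X (chains_in X (below X s1 :\ s1)) * cwt)).

Lemma sub_mulDr (R : nzRingType) (x p a b : R) :
  x - p * a - p * b = x - p * (a + b).
Proof. by rewrite mulrDr opprD addrA. Qed.

(** The two sums of rank words that occur for an ordinary coatom: over the chains
    of the boundary, which index the middle chains, and over the chains of the
    class that are left when the top chains of the former are taken away. *)
Lemma ordinary_positive X P s Q : step_spec X P -> s \in ordinary X P ->
  s \in initials (suspGamma X P s) Q -> cd_positive (suspGamma X P s) Q ->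
  exists2 n, dimn X = n.+2 &
    cdsum n (Psi n X (chains_in X (bdry X P s))) /\
    cdsum n.+1 (Psi n.+1 X (class_chains X P s)
                - Psi n X (chains_in X (bdry X P s)) * vb).
Proof.
move=> SX os iniY [_]; have spec := step_ordinary SX os.
have d_gt0 := step_dimn_gt0 SX.
have dY := dimn_susp spec; have := dimn_susp_gt0 spec d_gt0.
case def_n: (dimn (suspGamma X P s)) => [//|n] _; rewrite def_n in dY.
have r2 : (2 <= rank (suspGamma X P s) (top (suspGamma X P s)))%N.
  by move: def_n; rewrite /dimn; case: (rank _ _) => // -[].
move/(_ r2 s iniY); rewrite (below_susp_coatom spec) (chains_bdE spec) /=.
have -> : Psi n (suspGamma X P s) (chains_in X (bdry X P s)) = Psi n X (chains_in X (bdry X P s)).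
  by apply: eq_Psi => C /(ranks_bd spec).
move=> [posbd posY]; exists n; first by rewrite -dY.
split; first exact: posbd.
by rewrite (Psi_class spec (esym dY)) sub_mulDr.
Qed.

(** By induction, every summand in [Psi_step] is a sum of cd-words. *)
Lemma S_partition_positive X P : S_partition X P -> cd_positive X P.
Proof.
elim=> {X P} [X P eulX r1 _|X P s1 st P1 Q eulX r2 cpX ini SF posF rkF ter nE rkG clo dis SY posY rkY iniY].
  have d0 : dimn X = 0%N by rewrite /dimn r1.
  split; last by rewrite r1.
  rewrite d0 Psi_rank1 //; first exact: cdsum_one.
  by case: eulX => -[].
have SX : step_spec X P.
  apply: (S_partition_step_spec _ r2).
  exact: (S_partition_step eulX r2 cpX ini SF rkF ter nE rkG clo dis SY rkY iniY).
have posX := step_poset SX.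
have [C1 Ps1] : s1 \in coatoms X /\ P s1 = below X s1.
  have : s1 \in initials X P by rewrite ini set11.
  by rewrite inE => /andP[C1 /eqP].
have lowF := lower_strict_below posX (coatom_elt C1) (coatom_neq_top posX C1).
have pos1 : cdsum (dimn X).-1 (Psi (dimn X).-1 X (chains_in X (below X s1 :\ s1))).
  case: posF => + _; rewrite Ps1 (face_Delta lowF).
  have -> : dimn (face_poset X (below X s1 :\ s1)) = (dimn X).-1.
    by rewrite /dimn -Ps1 -rkF.
  set F := face_poset _ _.
  have -> // : Psi (dimn X).-1 F (chains_in X (below X s1 :\ s1))
     = Psi (dimn X).-1 X (chains_in X (below X s1 :\ s1)).
  apply: eq_Psi => C; rewrite chains_inE => /andP[_ /subsetP sC] x /sC.
  exact: face_rank.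
have posR : cdsum (dimn X) (Psi (dimn X) X (Delta X)
       - Psi (dimn X).-1 X (chains_in X (below X s1 :\ s1)) * cwt).
  rewrite (Psi_step SX) ?ini ?set11 //; apply: cdsum_sum => s os.
  have [n dX [posbd posC]] := ordinary_positive SX os (iniY s os) (posY s os).
  rewrite dX (Psi_bd SX os dX) cd_algebra.
  by apply: cdsumD; [apply: cdsumMc posC | apply: cdsumMd posbd].
split; last first.
  move=> _ s; rewrite ini in_set1 => /eqP ->.
  by split; [exact: pos1 | exact: posR].
have := cdsumMc pos1; rewrite prednK ?(step_dimn_gt0 SX) // => /(cdsumD posR).
by rewrite subrK.
Qed.

End SPartitions.

(** * Top chains *)

Section TopChains.
Variable T : finType.
Implicit Types (X Y : fposet T) (P Q : T -> {set T}) (x y z p s : T) (C F G : {set T}).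

Lemma bottom_chainE X P s G : step_spec X P -> s \in coatoms X ->
  G \in class_chains X P s -> bottom_chain X P G = s |: G.
Proof.
move=> SX Cs; rewrite inE => /andP[lowG Pp].
rewrite setUC; congr (_ :|: _); apply/setP => s'; rewrite in_set1.
apply/idP/eqP => [|->]; last by rewrite [s \in _]inE Cs.
rewrite [s' \in _]inE => /andP[Cs' Pp'].
exact: (class_unique (step_partition SX) Cs' Cs Pp' Pp).
Qed.

Lemma low_notin_coatom X s G : s \in coatoms X -> G \in low_chains X -> s \notin G.
Proof.
move=> Cs; rewrite low_inE => /andP[_ ]; apply: contra => Gs.
by apply/ranksP; exists s; rewrite ?coatom_rank.
Qed.

Lemma initial_notin_terminals X P s : is_poset X -> (0 < dimn X)%N ->
  s \in initials X P -> s \notin terminals X P.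
Proof.
move=> posX d_gt0; rewrite inE => /andP[Cs /eqP Ps]; rewrite inE Ps.
apply/negP => /andP[_ /eqP bs]; have Xs := coatom_elt Cs.
have : bot X \in below X s by rewrite belowE (bot_elt posX) (ple_bot posX).
rewrite bs in_set1 => /eqP b0.
by move: d_gt0; rewrite -(coatom_rank Cs) -b0 (rank_bot posX).
Qed.

(** A free chain cannot contain the initial coatom [s]: removing [s] would leave a
    chain of the boundary of [s], whose bottom chain is the given one. *)
Lemma top_chain_spec Y Q B t s : S_partition Y Q -> (0 < dimn Y)%N ->
  s \in initials Y Q -> block_decomposition Y Q B t ->
  {in chains_in Y (below Y s :\ s), forall F,
     [/\ t F \in Delta Y, s \notin t F & ranks Y (t F) =i dimn Y :: ranks Y F]}
  /\ {in chains_in Y (below Y s :\ s) &, injective t}.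
Proof.
move=> SY d_gt0 ini bd.
have r2 : (2 <= rank Y (top Y))%N.
  by move: d_gt0; rewrite /dimn; case: (rank Y (top Y)) => // -[].
have SS := S_partition_step_spec SY r2; have posY := step_poset SS.
have [Cs Qs] : s \in coatoms Y /\ Q s = below Y s.
  by move: ini; rewrite inE => /andP[Cs /eqP].
have lowF F : F \in chains_in Y (below Y s :\ s) -> F \in low_chains Y.
  by rewrite (chains_below posY Cs d_gt0) inE => /andP[].
case: bd SS SY d_gt0 ini r2 posY Cs Qs lowF => {Y Q B t}
  [Y Q B t -> // | Y Q B t s1 st d1 _ ter t0 _ | Y Q B t Q' Bs ts _ _ _ _ inj_t im_t rk_t _]
  SS SY d_gt0 ini r2 posY Cs Qs lowF.
  have F0 F : F \in chains_in Y (below Y s :\ s) -> F = set0.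
    move=> inF; apply/setP => x; rewrite in_set0; apply/negP => Fx.
    have := low_rank posY (lowF F inF) Fx; rewrite d1 ltnNge.
    by rewrite (Delta_rank_gt0 posY (low_Delta (lowF F inF))).
  split=> [F inF|F F' /F0 -> /F0 ->] //; rewrite (F0 F inF) t0.
  have Cst : st \in coatoms Y.
    have : st \in terminals Y Q by rewrite ter set11.
    by rewrite inE => /andP[].
  have Yst := coatom_elt Cst; split.
  - apply/DeltaP; split.
    + by rewrite sub1set.
    + by rewrite in_set1 eq_sym -(rank_gt0 posY) // coatom_rank // d1.
    + by rewrite in_set1 eq_sym (coatom_neq_top posY).
    + by move=> x y /set1P-> /set1P->; rewrite (ple_refl posY).
  - by have := initial_notin_terminals posY d_gt0 ini; rewrite ter in_set1.
  - move=> i; rewrite in_cons; apply/ranksP/orP.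
      by case=> x /set1P-> ->; left; rewrite coatom_rank.
    case=> [/eqP->|/ranksP[x]]; last by rewrite in_set0.
    by exists st; rewrite ?set11 ?coatom_rank.
split; last by move=> F F' /lowF lF /lowF lF'; apply: inj_t.
move=> F /lowF lF; have : t F \in free_chains Y Q ts by rewrite -im_t imset_f.
rewrite in_setD => /andP[not_used DtF]; split=> //; last exact: rk_t.
apply: contra not_used => ts_s.
have rem := rem_coatom posY Cs DtF ts_s.
have lowG := lowF _ rem; apply/bigcupP; exists (t F :\ s) => //.
rewrite /partial_block in_setU in_set2.
rewrite (@bottom_chainE _ _ s) //; first by rewrite setD1K ?eqxx.
by rewrite (class_chains_below SS Cs Qs).
Qed.

(** In the semisuspension the top chain of a boundary chain reaches the top rank
    without using the added coatom, so it leaves the boundary and its largest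
    element lies in the class of [s]. *)
Lemma middle_top_chain X P s Q B t :
  step_spec X P -> s \in ordinary X P ->
  S_partition (suspGamma X P s) Q -> s \in initials (suspGamma X P s) Q ->
  block_decomposition (suspGamma X P s) Q B t ->
  {in chains_in X (boundary (Gamma X P s)), forall F,
     t F \in class_chains X P s /\ ranks X (t F) =i (dimn X).-1 :: ranks X F}
  /\ {in chains_in X (boundary (Gamma X P s)) &, injective t}.
Proof.
move=> SX os SY ini bd; have spec := step_ordinary SX os.
have d_gt0 := step_dimn_gt0 SX; have dY0 := dimn_susp_gt0 spec d_gt0.
have [] := top_chain_spec SY dY0 ini bd.
rewrite (below_susp_coatom spec) (chains_bdE spec) => tP inj_t; split=> // F inF.
have [DtF ns rk] := tP F inF.
have rkF : ranks (suspGamma X P s) F =i ranks X F by apply: eq_ranks; apply: ranks_bd.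
have tFL : t F \in chains_in X (lower_closure X (P s :\ s)) by rewrite -(Delta_suspE spec).
have rkt : ranks (suspGamma X P s) (t F) =i ranks X (t F).
  apply: eq_ranks => x tx; apply: (rank_suspE spec).
  by move: tFL; rewrite chains_inE => /andP[_ /subsetP->].
split; last by move=> i; rewrite -rkt rk !in_cons rkF -(dimn_susp spec).
rewrite (class_chainsE spec d_gt0) inE DtF ns /=.
apply/negP => /subsetP sb.
have : dimn (suspGamma X P s) \in ranks (suspGamma X P s) (t F) by rewrite rk mem_head.
by rewrite rkt => /ranksP[x tx dx]; have := bd_rank spec (sb x tx); rewrite -dx ltnn.
Qed.

End TopChains.

(** * Unions and images of partitions *)

Section Partitions.
Variables (I J : finType).
Implicit Types (S A : {set I}) (M : {set {set I}}).

Lemma partitionU M1 M2 A1 A2 : partition M1 A1 -> partition M2 A2 ->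
  [disjoint A1 & A2] -> partition (M1 :|: M2) (A1 :|: A2).
Proof.
case/and3P=> /eqP cov1 tri1 no1 /and3P[/eqP cov2 tri2 no2] dis.
apply/and3P; split.
- by rewrite /cover bigcup_setU -/(cover M1) -/(cover M2) cov1 cov2.
- by rewrite trivIsetU ?cov1 ?cov2.
- by rewrite in_setU negb_or no1 no2.
Qed.

Lemma partition_imset (h : I -> J) M S : {in S &, injective h} -> partition M S ->
  partition [set h @: N | N : {set I} in M] (h @: S).
Proof.
move=> injh parM; apply/and3P; split.
- apply/eqP/setP => y; apply/bigcupP/imsetP => [[_ /imsetP[N MN ->] /imsetP[i Ni ->]]|[i Si ->]].
    by exists i => //; apply: (subsetP (partitionS parM MN)).
  move: Si; rewrite -(cover_partition parM) => /bigcupP[N MN Ni].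
  by exists (h @: N); apply: imset_f.
- apply/trivIsetP=> _ _ /imsetP[N MN ->] /imsetP[N' MN' ->] neq.
  have /trivIsetP/(_ N N' MN MN') := partition_trivIset parM.
  have [NN'|_ /(_ isT) dis] := eqVneq N N'; first by rewrite NN' eqxx in neq.
  apply/pred0P => y; apply/negP => /andP[/imsetP[i Ni ->] /imsetP[j Nj eq_ij]].
  have ij : i = j.
    by apply: injh eq_ij; [apply: (subsetP (partitionS parM MN)) | apply: (subsetP (partitionS parM MN'))].
  by have /pred0P/(_ i) := dis; rewrite /= Ni ij Nj.
- apply/negP => /imsetP[N MN /esym/eqP]; rewrite imset_eq0.
  by apply/negP/(partition_neq0 parM).
Qed.

End Partitions.

(** * Merging the blocks of a coatom *)

Definition letter_value (R : nzRingType) (l : cd_letter) (a b : R) : R :=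
  (if l is Letter_c then a + b else a * b + b * a)%R.

(** [u] is the word of the index of the block; the terms come from the top chain,
    the bottom chain and the index itself. *)
Lemma c_block (R : nzRingType) (u a b : R) :
  (u * b + (u * b + u * (a - b)) = u * (a + b))%R.
Proof. by rewrite -!mulrDr; congr (_ * _)%R; rewrite subrKC addrC. Qed.

(** [v] is the word of the boundary chain.  The index of the block has the word
    [v] followed by b, and the middle chain [v] followed by ab, where a stands for
    the a - b of the substitution. *)
Lemma d_block (R : nzRingType) (v a b : R) :
  (v * b * (a + b) + v * (a - b) * b = v * (a * b + b * a))%R.
Proof.
rewrite -!mulrA -mulrDr; congr (_ * _)%R.
by rewrite mulrDr mulrBl addrACA subrr addr0 addrC.
Qed.

Section Blocks.
Variables (T : finType) (X : fposet T) (P : T -> {set T}).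
Variables (B : {set T} -> {set {set T}}) (t : {set T} -> {set T}).
Variable ts : T -> {set T} -> {set T}.
Implicit Types (x y z p s : T) (C F G : {set T}).
Local Notation bdry s := (boundary (Gamma X P s)).
Local Open Scope ring_scope.

Hypothesis SX : step_spec X P.
Hypothesis tsP : {in ordinary X P, forall s, {in chains_in X (bdry s), forall F,
  ts s F \in class_chains X P s /\ ranks X (ts s F) =i (dimn X).-1 :: ranks X F}}.
Hypothesis ts_inj : {in ordinary X P, forall s, {in chains_in X (bdry s) &, injective (ts s)}}.
Hypothesis t_inj : {in low_chains X &, injective t}.
Hypothesis t_im : t @: low_chains X = free_chains X P ts.
Hypothesis t_rk : {in low_chains X, forall G, ranks X (t G) =i dimn X :: ranks X G}.
Hypothesis defB : {in low_chains X, forall G, B G = t G |: partial_block X P ts G}.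

Let posX := step_poset SX.
Let d_gt0 := step_dimn_gt0 SX.

Lemma class_low s G : G \in class_chains X P s -> G \in low_chains X.
Proof. by rewrite inE => /andP[]. Qed.

Lemma class_chains_unique s s' G : s \in coatoms X -> s' \in coatoms X ->
  G \in class_chains X P s -> G \in class_chains X P s' -> s = s'.
Proof.
move=> Cs Cs'; rewrite inE => /andP[_ Ps]; rewrite inE => /andP[_ Ps'].
exact: (class_unique (step_partition SX) Cs Cs' Ps Ps').
Qed.

Lemma class_chains_exists G : G \in low_chains X ->
  exists2 s, s \in coatoms X & G \in class_chains X P s.
Proof.
move=> lowG; have DG := low_Delta lowG.
have [s Cs Ps] := class_exists (step_partition SX) (largest_elt posX DG) (largest_neq_top posX d_gt0 DG).
by exists s; rewrite // inE lowG.
Qed.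

Lemma middle_chainsP G F :
  reflect (exists s Fh, [/\ s \in ordinary X P, Fh \in chains_in X (bdry s),
                           ts s Fh = G & F = s |: Fh])
          (F \in middle_chains X P ts G).
Proof.
have DE s : s \in ordinary X P -> Delta (bdGamma X P s) = chains_in X (bdry s).
  by move=> os; rewrite [LHS](face_Delta (bd_lower (step_ordinary SX os))).
apply: (iffP imset2P) => [[s Fh os]|[s [Fh [os inF tF ->]]]].
  by rewrite inE DE // => /andP[inF /eqP tF] ->; exists s, Fh.
by exists s Fh; rewrite // inE DE // inF tF eqxx.
Qed.

Lemma bd_notin_class s Fh : s \in ordinary X P -> Fh \in chains_in X (bdry s) ->
  largest X Fh \notin P s.
Proof.
move=> os; rewrite chains_inE => /andP[DF sF]; have spec := step_ordinary SX os.
have bL : largest X Fh \in bdry s.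
  by rewrite (largest_lower posX (bd_lower spec)) // bd_bot.
apply/negP => Pl; have /pred0P/(_ (largest X Fh)) := ord_disjoint spec.
rewrite /= in_setD1 Pl bL !andbT => /negbFE/eqP ls.
by have := coatom_notin_bd spec; rewrite -{1}ls bL.
Qed.

Lemma bd_notin_chain s Fh : s \in ordinary X P -> Fh \in chains_in X (bdry s) -> s \notin Fh.
Proof.
move=> os; rewrite chains_inE => /andP[_ /subsetP sF].
by apply: contra (coatom_notin_bd (step_ordinary SX os)) => /sF.
Qed.

(** It recovers the index of a block from any chain except the top chain.  The
    index itself contains no coatom.  A bottom or middle chain contains one coatom
    [s], and removing it leaves either a chain with largest element in the class of
    [s], which is the index, or a chain of the boundary, and then the index is the
    top chain of that chain. *)
Definition block_key F : {set T} :=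
  if [pick s in coatoms X | s \in F] is Some s then
    if largest X (F :\ s) \in P s then F :\ s else ts s (F :\ s)
  else F.

Lemma block_key_add s G : s \in coatoms X -> s \notin G ->
  (forall s', s' \in coatoms X -> s' \in G -> false) ->
  block_key (s |: G) = if largest X G \in P s then G else ts s G.
Proof.
move=> Cs nGs nG; rewrite /block_key; case: pickP => [s' /andP[Cs' ]|/(_ s)]; last first.
  by rewrite Cs setU11.
by case/setU1P=> [->|/(nG s' Cs')//]; rewrite setU1K.
Qed.

Lemma partial_key G F : G \in low_chains X -> F \in partial_block X P ts G ->
  block_key F = G.
Proof.
move=> lowG; have [s Cs sG] := class_chains_exists lowG.
have nG s' : s' \in coatoms X -> s' \in G -> false.
  by move=> Cs' Gs'; have := low_notin_coatom Cs' lowG; rewrite Gs'.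
rewrite /partial_block in_setU in_set2 (bottom_chainE SX Cs sG).
case/orP=> [/orP[] /eqP ->|/middle_chainsP[s' [Fh [os inF <- ->]]]].
- by rewrite block_key_add ?(low_notin_coatom Cs) //; move: sG; rewrite inE => /andP[_ ->].
- by rewrite /block_key; case: pickP => // s' /andP[Cs' /(nG s' Cs')].
have Cs' := ordinary_coatom os; have spec := step_ordinary SX os.
rewrite block_key_add ?(bd_notin_chain os) ?(negPf (bd_notin_class os inF)) //.
move=> s0 Cs0 Fs0; move: inF; rewrite chains_inE => /andP[_ /subsetP/(_ s0 Fs0)/(bd_rank spec)].
by rewrite coatom_rank // -(dimn_susp spec) ltnNge leqW.
Qed.

Lemma top_free G G' : G \in low_chains X -> G' \in low_chains X ->
  t G \notin partial_block X P ts G'.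
Proof.
move=> lowG lowG'; have : t G \in free_chains X P ts by rewrite -t_im imset_f.
rewrite in_setD => /andP[+ _]; apply: contra => tG.
by apply/bigcupP; exists G'.
Qed.

(** Blocks are disjoint: top chains are injective and free, and for the other
    chains the index is given by [block_key]. *)
Lemma block_inj G G' F : G \in low_chains X -> G' \in low_chains X ->
  F \in B G -> F \in B G' -> G = G'.
Proof.
move=> lG lG'; rewrite !defB //.
case/setU1P=> [->|FG]; case/setU1P=> [|FG'].
- exact: t_inj.
- by have := top_free lG lG'; rewrite FG'.
- by move=> Ft; have := top_free lG' lG; rewrite -Ft FG.
- by rewrite -(partial_key lG FG) (partial_key lG' FG').
Qed.

Lemma low_in_block G : G \in low_chains X -> G \in B G.
Proof. by move=> lG; rewrite defB // in_setU1 in_setU in_set2 eqxx !orbT. Qed.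

Lemma B_inj : {in low_chains X &, injective B}.
Proof.
move=> G G' lG lG' eqB; apply: (block_inj lG lG' (low_in_block lG)).
by rewrite -eqB low_in_block.
Qed.

Lemma sum_blocks (R : nmodType) (f : {set T} -> R) (A : {set {set T}}) :
  A \subset low_chains X ->
  \sum_(F in cover (B @: A)) f F = \sum_(G in A) \sum_(F in B G) f F.
Proof.
move=> /subsetP sA; rewrite big_trivIset /=; last first.
  apply/trivIsetP=> _ _ /imsetP[G AG ->] /imsetP[G' AG' ->] neq.
  apply/pred0P => F; apply/negP => /andP[/= FG FG']; case/eqP: neq; congr (B _).
  exact: (block_inj (sA _ AG) (sA _ AG') FG FG').
by rewrite big_imset // => G G' /sA lG /sA lG'; apply: B_inj.
Qed.

Definition wt (F : {set T}) : abring := ab_word (dimn X) (ranks X F) (va - vb) vb.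

Lemma sum_block G s : s \in coatoms X -> G \in class_chains X P s ->
  \sum_(F in B G) wt F
  = ab_word (dimn X).-1 (ranks X G) (va - vb) vb * (va + vb)
    + \sum_(F in middle_chains X P ts G) wt F.
Proof.
move=> Cs sG; have lowG := class_low sG.
have nGs := low_notin_coatom Cs lowG.
rewrite defB // big_setU1 ?top_free //=.
rewrite (eq_bigl [predU [set bottom_chain X P G; G] & middle_chains X P ts G]); last first.
  by move=> F; rewrite /partial_block in_setU.
rewrite bigU /=; last first.
  rewrite (bottom_chainE SX Cs sG); apply/pred0P => F; apply/negP => /andP[/= + FM].
  case/middle_chainsP: FM => s' [Fh [os inF tF ->]].
  have Cs' := ordinary_coatom os.
  have ss' : s' = s.
    have [sG' _] := tsP os inF; rewrite tF in sG'.
    exact: class_chains_unique Cs' Cs sG' sG.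
  subst s'.
  rewrite in_set2 => /orP[] /eqP eqF; last by rewrite -eqF setU11 in nGs.
  have FG : Fh = G by rewrite -(setU1K (bd_notin_chain os inF)) eqF setU1K.
  have := bd_notin_class os inF; rewrite FG.
  by move: sG; rewrite inE => /andP[_ ->].
rewrite (bottom_chainE SX Cs sG) big_setU1 ?big_set1 /=; last first.
  by rewrite in_set1; apply: contra nGs => /eqP <-; apply: setU11.
rewrite addrA; congr (_ + _).
have dd : dimn X = (dimn X).-1.+1 by rewrite prednK.
set u := ab_word (dimn X).-1 (ranks X G) (va - vb) vb.
have eq_u K : (forall i, (i <= (dimn X).-1)%N -> (i \in K) = (i \in ranks X G)) ->
    ab_word (dimn X).-1 K (va - vb) vb = u.
  by move=> eqK; apply: eq_ab_word => i /andP[_ /eqK].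
have -> : wt G = u * (va - vb).
  rewrite /wt {1}dd ab_word_recr -dd ifN //.
  by move: lowG; rewrite low_inE => /andP[].
have -> : wt (t G) = u * vb.
  rewrite /wt {1}dd ab_word_recr -dd (t_rk lowG) mem_head eq_u // => i le_i.
  by rewrite (t_rk lowG) in_cons; case: eqP => // ie; move: le_i; rewrite ie leqNgt prednK ?leqnn.
have -> : wt (s |: G) = u * vb.
  rewrite /wt ab_word_add_coatom //.
  by rewrite (chains_below posX Cs d_gt0) inE lowG; have := class_below (step_partition SX) Cs;
     move: sG; rewrite inE => /andP[_ Pp] /subsetP/(_ _ Pp); rewrite belowE => /andP[].
exact: c_block.
Qed.

Lemma middle_nil G s : s \in coatoms X -> G \in class_chains X P s ->
  (forall Fh, s \in ordinary X P -> Fh \in chains_in X (bdry s) -> ts s Fh != G) ->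
  middle_chains X P ts G = set0.
Proof.
move=> Cs sG nomid; apply/setP => F; rewrite in_set0; apply/negP.
case/middle_chainsP=> s' [Fh [os inF tF _]].
have [sG' _] := tsP os inF; rewrite tF in sG'.
have ss' := class_chains_unique (ordinary_coatom os) Cs sG' sG; subst s'.
by move: (nomid Fh os inF); rewrite tF eqxx.
Qed.

Lemma middle_one s Fh : s \in ordinary X P -> Fh \in chains_in X (bdry s) ->
  middle_chains X P ts (ts s Fh) = [set s |: Fh].
Proof.
move=> os inF; have [sG _] := tsP os inF.
apply/setP => F; rewrite in_set1; apply/middle_chainsP/eqP => [|->]; last by exists s, Fh.
case=> s' [Fh' [os' inF' tF ->]].
have [sG' _] := tsP os' inF'; rewrite tF in sG'.
have ss' := class_chains_unique (ordinary_coatom os') (ordinary_coatom os) sG' sG; subst s'.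
by congr (_ |: _); apply: ts_inj tF.
Qed.

Definition mergeable (A : {set {set T}}) : Prop :=
  exists2 M, partition M (B @: A) &
    forall N, N \in M -> exists w, contributes X (cover N) w.

Lemma mergeable0 : mergeable set0.
Proof.
exists set0; last by move=> N; rewrite inE.
by rewrite imset0 partition_set0.
Qed.

Lemma mergeableU (A1 A2 : {set {set T}}) : A1 \subset low_chains X -> A2 \subset low_chains X ->
  [disjoint A1 & A2] -> mergeable A1 -> mergeable A2 -> mergeable (A1 :|: A2).
Proof.
move=> /subsetP s1 /subsetP s2 dis [M1 par1 M1P] [M2 par2 M2P].
exists (M1 :|: M2); last by move=> N /setUP[/M1P|/M2P].
rewrite imsetU; apply: partitionU par1 par2 _.
apply/pred0P => b; apply/negP => /andP[/imsetP[G AG ->] /imsetP[G' AG' eqB]].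
have GG' := B_inj (s1 _ AG) (s2 _ AG') eqB; have /pred0P/(_ G) := dis.
by rewrite /= AG GG' AG'.
Qed.

Lemma sum_word_eval_group (a b : abring) (I : finType) (v : I -> seq bool) (N : {set I}) w :
  perm_eq [seq v i | i in N] (cd_words w) ->
  \sum_(i in N) word_eval a b (v i)
  = cd_word w (a + b + b) (a * b + b * a + b * b + b * b).
Proof.
by move=> permN; rewrite -sum_cd_words -(perm_big _ permN) /= big_image.
Qed.

Lemma letter_c_subst (R : nzRingType) (a b : R) : a - b + b + b = a + b.
Proof. by rewrite subrK. Qed.

Lemma letter_d_subst (R : nzRingType) (a b : R) :
  (a - b) * b + b * (a - b) + b * b + b * b = a * b + b * a.
Proof.
by rewrite mulrBl mulrBr addrA subrK addrAC subrK.
Qed.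

(** A grouping of the index set [S] by cd-words [w] becomes a grouping of blocks by
    the words [w] followed by [l].  [K] gives the rank set attached to an index,
    which differs from the rank set of the chain [g i] when [l] is d. *)
Lemma mergeable_image (I : finType) (S : {set I}) (g : I -> {set T})
    (K : I -> seq nat) m l :
  {in S &, injective g} -> g @: S \subset low_chains X ->
  (forall i, i \in S -> \sum_(F in B (g i)) wt F
      = ab_word m (K i) (va - vb) vb * letter_value l va vb) ->
  (m + (if l is Letter_c then 1 else 2) = dimn X)%N ->
  cdsum m (\sum_(i in S) ab_word m (K i) va vb) ->
  mergeable (g @: S).
Proof.
move=> injg sgS wtB deg pos.
have [|M parM MP] := @grouping I (fun i => word m (K i)) m S.
  by rewrite -(eq_bigr _ (fun i _ => ab_wordE m (K i) va vb)).
have sub N : N \in M -> {subset N <= S} by move=> MN; apply/subsetP/(partitionS parM MN).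
exists [set (B \o g) @: N | N : {set I} in M].
  rewrite -imset_comp; apply: partition_imset => // i j Si Sj eqB.
  by apply: injg => //; apply: B_inj => //; apply: (subsetP sgS); apply: imset_f.
move=> _ /imsetP[N MN ->]; have [w dw permw] := MP N MN; exists (rcons w l); split.
  by rewrite cd_degree_rcons dw deg.
rewrite imset_comp sum_blocks; last first.
  by apply: subset_trans sgS; apply: imsetS; apply/subsetP/sub.
rewrite big_imset /=; last by move=> i j Ni Nj; apply: injg; apply: (sub N MN).
rewrite (eq_bigr _ (fun i Ni => wtB i (sub N MN i Ni))) -mulr_suml.
rewrite (eq_bigr _ (fun i _ => ab_wordE m (K i) (va - vb) vb)).
rewrite (sum_word_eval_group _ _ permw) letter_c_subst letter_d_subst.
rewrite cd_word_rcons; congr (_ * _).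
Qed.

Lemma merge_without_middle s (A : {set {set T}}) : s \in coatoms X ->
  A \subset class_chains X P s ->
  (forall Fh G, s \in ordinary X P -> Fh \in chains_in X (bdry s) -> G \in A -> ts s Fh != G) ->
  cdsum (dimn X).-1 (Psi (dimn X).-1 X A) -> mergeable A.
Proof.
move=> Cs /subsetP sA nomid pos; rewrite -[A]imset_id.
apply: (mergeable_image (K := ranks X) (m := (dimn X).-1) (l := Letter_c)).
- by [].
- by rewrite imset_id; apply/subsetP => G /sA; apply: class_low.
- move=> G AG; rewrite (sum_block Cs (sA _ AG)) (middle_nil Cs (sA _ AG)) ?big_set0 ?addr0 //.
  by move=> Fh os inF; apply: nomid.
- by rewrite addn1 prednK.
- exact: pos.
Qed.

(** A block with middle chain is indexed by the boundary chain from which the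
    middle chain is made, and its value is the word of that chain times d. *)
Lemma merge_with_middle s n : s \in ordinary X P -> dimn X = n.+2 ->
  cdsum n (Psi n X (chains_in X (bdry s))) ->
  mergeable (ts s @: chains_in X (bdry s)).
Proof.
move=> os dX pos; have spec := step_ordinary SX os; have Cs := ordinary_coatom os.
apply: (mergeable_image (K := ranks X) (m := n) (l := Letter_d)).
- exact: ts_inj.
- by apply/subsetP => _ /imsetP[Fh inF ->]; have [/class_low] := tsP os inF.
- move=> Fh inF; have [sG rk] := tsP os inF.
  rewrite (sum_block Cs sG) (middle_one os inF) big_set1.
  have ltn x : x \in Fh -> (rank X x <= n)%N.
    move: inF; rewrite chains_inE => /andP[_ /subsetP sF] /sF /(bd_rank spec).
    by have := dimn_susp spec; rewrite dX => -[->].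
  have nF i : (n < i)%N -> (i \in ranks X Fh) = false.
    by move=> lt_ni; apply/negP => /ranksP[x /ltn + ix]; rewrite -ix leqNgt lt_ni.
  have inB : Fh \in chains_in X (below X s :\ s).
    move: inF; rewrite !chains_inE => /andP[-> sF]; apply: subset_trans sF _.
    exact: subset_trans (bd_sub_Gamma spec) (Gamma_sub_below spec).
  rewrite /wt ab_word_add_coatom // dX /= !ab_word_recr (nF n.+1) //.
  rewrite rk dX mem_head (@eq_ab_word n (ranks X (ts s Fh)) (ranks X Fh)); last first.
    move=> i /andP[_ le_in]; rewrite rk dX in_cons.
    by case: eqP => // ie; move: le_in; rewrite ie ltnn.
  exact: d_block.
- by rewrite addn2 dX.
- exact: pos.
Qed.

Lemma blocks_ofE s : s \in coatoms X -> blocks_of X P B s = B @: class_chains X P s.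
Proof.
move=> Cs; apply/setP => b; apply/imsetP/imsetP => -[G GP ->]; exists G => //.
  move: GP; rewrite [G \in _]inE => /andP[lowG]; have [s' Cs' sG] := class_chains_exists lowG.
  rewrite (bottom_chainE SX Cs' sG) in_setU1 (negPf (low_notin_coatom Cs lowG)) orbF.
  by move=> /eqP ->.
by rewrite [G \in _]inE (class_low GP) (bottom_chainE SX Cs GP) setU11.
Qed.

(** For an ordinary coatom the blocks with and without a middle chain are merged
    separately; the rank words of their indices have the two sums of
    [ordinary_positive]. *)
Lemma merge_coatom s : s \in coatoms X -> cd_positive X P ->
  (s \in ordinary X P -> exists2 Q, s \in initials (suspGamma X P s) Q
     & cd_positive (suspGamma X P s) Q) ->
  mergeable (class_chains X P s).
Proof.
move=> Cs [_ posX'] posY.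
have [Ps|Ps|os] := coatom_cases P Cs.
- have ini : s \in initials X P by rewrite inE -Ps eqxx andbT; exact: Cs.
  apply: (merge_without_middle Cs (subxx _)).
    by move=> Fh G; rewrite in_setD in_setU ini.
  rewrite (class_chains_below SX Cs Ps).
  by have [] := posX' (step_rank SX) s ini.
- by rewrite (class_chains_terminal SX Cs Ps); apply: mergeable0.
have [Q iniQ posQ] := posY os.
have [n dX [posbd posC]] := ordinary_positive SX os iniQ posQ.
set A1 := ts s @: chains_in X (bdry s).
have sA1 : A1 \subset class_chains X P s.
  by apply/subsetP => _ /imsetP[Fh inF ->]; have [] := tsP os inF.
have sL : class_chains X P s \subset low_chains X by apply/subsetP => G; apply: class_low.
have -> : class_chains X P s = A1 :|: (class_chains X P s :\: A1).
  by rewrite -{1}(setID (class_chains X P s) A1) (setIidPr sA1).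
apply: mergeableU.
- exact: subset_trans sA1 sL.
- by apply: subset_trans sL; apply: subsetDl.
- by rewrite disjoint_sym disjoints_subset setDE subsetIr.
- exact: (merge_with_middle os dX posbd).
apply: (merge_without_middle Cs (subsetDl _ _)).
  move=> Fh G _ inF; rewrite in_setD => /andP[+ _]; apply: contraNneq => <-.
  exact: imset_f.
have dX1 : (dimn X).-1 = n.+1 by rewrite dX.
have eqPsi : Psi n.+1 X (class_chains X P s :\: A1)
   = Psi n.+1 X (class_chains X P s) - Psi n X (chains_in X (bdry s)) * vb.
  have -> : Psi n X (chains_in X (bdry s)) * vb = Psi n.+1 X A1.
    rewrite [RHS]big_imset; last exact: ts_inj.
    rewrite /Psi mulr_suml; apply: eq_bigr => Fh inF /=.
    have [_ rk] := tsP os inF; rewrite dX1 in rk.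
    rewrite ab_word_recr rk mem_head; congr (_ * _); apply: eq_ab_word => i /andP[_ le_in].
    by rewrite rk in_cons; case: eqP => // ie; move: le_in; rewrite ie ltnn.
  rewrite [Psi n.+1 X (class_chains X P s)](big_setID A1) (setIidPr sA1) /=.
  by rewrite addrAC subrr add0r.
by rewrite dX1 eqPsi.
Qed.

End Blocks.

(** * Small ranks and conclusion *)

Section Main.
Variable T : finType.
Implicit Types (X : fposet T) (P : T -> {set T}) (s : T).
Local Open Scope ring_scope.

(** In rank at most two there is a single block, that of the empty chain. *)
Lemma low_chains_small X : is_poset X -> (dimn X <= 1)%N -> low_chains X = [set set0].
Proof.
move=> posX d1; apply/setP => C; rewrite in_set1; apply/idP/eqP => [lowC|->].
  apply/setP => x; rewrite in_set0; apply/negP => Cx.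
  have := leq_trans (low_rank posX lowC Cx) d1; rewrite ltnS leqNgt.
  by rewrite (Delta_rank_gt0 posX (low_Delta lowC)).
rewrite low_inE; apply/andP; split; last by apply/ranksP => -[x]; rewrite in_set0.
by apply/DeltaP; split; rewrite ?sub0set ?in_set0 // => x y; rewrite in_set0.
Qed.

Lemma merge_small X P (B : {set T} -> {set {set T}}) s : is_poset X -> (dimn X <= 1)%N ->
  (exists w, contributes X (B set0) w) ->
  exists M, partition M (blocks_of X P B s) /\
    forall N, N \in M -> exists w, contributes X (cover N) w.
Proof.
move=> posX d1 [w Bw].
have [bs|nbs] := boolP (s \in bottom_chain X P set0).
  have -> : blocks_of X P B s = [set B set0].
    apply/setP => b; rewrite in_set1; apply/imsetP/eqP => [[G]|->].
      by rewrite inE low_chains_small // in_set1 => /andP[/eqP-> _ ->].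
    by exists set0; rewrite // inE low_chains_small // set11.
  exists [set [set B set0]]; split.
    apply/and3P; split; rewrite ?cover1 ?trivIset1 // in_set1 eq_sym.
    by apply/set0Pn; exists (B set0); apply: set11.
  by move=> N /set1P->; exists w; rewrite cover1.
have -> : blocks_of X P B s = set0.
  apply/setP => b; rewrite in_set0; apply/imsetP => -[G].
  by rewrite inE low_chains_small // in_set1 => /andP[/eqP->]; rewrite (negPf nbs).
by exists set0; split; [rewrite partition_set0 | move=> N; rewrite in_set0].
Qed.

Lemma ab_word1 K (a b : abring) : ab_word 1 K a b = if 1%N \in K then b else a.
Proof. by rewrite /ab_word big_nat1. Qed.

Lemma contributes_dim1 X s1 st : s1 \in coatoms X -> st \in coatoms X -> s1 != st ->
  dimn X = 1%N -> contributes X [set [set s1]; set0; [set st]] [:: Letter_c].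
Proof.
move=> C1 Ct neq d1; split; first by rewrite /cd_degree big_seq1 d1.
have rk s : s \in coatoms X -> 1%N \in ranks X [set s].
  by move=> Cs; apply/ranksP; exists s; rewrite ?set11 // coatom_rank.
have r0 : (1%N \in ranks X set0) = false by apply/negP => /ranksP[x]; rewrite in_set0.
rewrite -setUA big_setU1 /=; last first.
  rewrite in_set2 negb_or; apply/andP; split; first by apply/set0Pn; exists s1; apply: set11.
  by apply: contra neq => /eqP/set1_inj->.
rewrite big_setU1 /=; last by rewrite in_set1 eq_sym; apply/set0Pn; exists st; apply: set11.
rewrite big_set1 d1 !ab_word1 !rk // r0 /cd_word big_seq1.
by rewrite subrK addrC.
Qed.

Theorem blocks_merge X P (B : {set T} -> {set {set T}}) (t : {set T} -> {set T}) s :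
  S_partition X P -> block_decomposition X P B t -> s \in coatoms X ->
  exists M : {set {set {set {set T}}}},
    partition M (blocks_of X P B s) /\
    forall N, N \in M -> exists w, contributes X (cover N) w.
Proof.
move=> SP bd; have posX : is_poset X by case: (S_partition_eulerian SP) => -[].
case: bd SP posX => {X P B t}
  [X P B t d0 B0 | X P B t s1 st d1 ini ter t0 B0
  | X P B t Q Bs ts d2 SY iniY bdY inj_t im_t rk_t defB] SP posX Cs.
- apply: merge_small; rewrite ?d0 //; exists [::]; rewrite B0.
  split; first by rewrite /cd_degree big_nil d0.
  by rewrite big_set1 d0 /ab_word big_geq // /cd_word big_nil.
- apply: merge_small; rewrite ?d1 //; exists [:: Letter_c]; rewrite B0.
  have i1 : s1 \in initials X P by rewrite ini set11.
  have tt : st \in terminals X P by rewrite ter set11.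
  apply: contributes_dim1 => //.
  + by move: i1; rewrite inE => /andP[].
  + by move: tt; rewrite inE => /andP[].
  + have := initial_notin_terminals posX _ i1; rewrite d1 ter in_set1; exact.
have r2 : (2 <= rank X (top X))%N by apply: leq_trans d2 _; apply: leq_pred.
have SX := S_partition_step_spec SP r2.
have tsP s' (os : s' \in ordinary X P) := middle_top_chain SX os (SY s' os) (iniY s' os) (bdY s' os).
have posY : s \in ordinary X P -> exists2 Q', s \in initials (suspGamma X P s) Q'
    & cd_positive (suspGamma X P s) Q'.
  by move=> os; exists (Q s); [apply: iniY | apply: S_partition_positive (SY s os)].
have [M parM MP] := merge_coatom SX (fun s' os => (tsP s' os).1)
  (fun s' os => (tsP s' os).2) inj_t im_t rk_t defB Cs (S_partition_positive SP) posY.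
exists M; split => //.
by rewrite (blocks_ofE B SX Cs).
Qed.

End Main.

Theorem corollary3p5 (disp : Order.disp_t) (Omega : finTBPOrderType disp)
    (P : Omega -> {set Omega})
    (B : {set Omega} -> {set {set Omega}}) (t : {set Omega} -> {set Omega}) :
  S_partition (poset_of Omega) P ->
  block_decomposition (poset_of Omega) P B t ->
  forall s : Omega, s \in coatoms (poset_of Omega) ->
  exists M : {set {set {set {set Omega}}}},
    partition M (blocks_of (poset_of Omega) P B s) /\
    forall N : {set {set {set Omega}}}, N \in M ->
    exists w : seq cd_letter, contributes (poset_of Omega) (cover N) w.
Proof. by move=> SP bd s Cs; apply: (blocks_merge SP bd Cs). Qed.
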